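(* Assume the standing assumptions and Assumption PLAIN below. There is a constant $C_{GSR}$, depending only on the good grid $\mathcal P$ (and the fixed parameters $s,\beta,p,q$), with the following property. Suppose $\{I_r\}_{r\in\Lambda}$ is a countable family of pairwise disjoint sets such that $\Omega=\bigcup_{r\in\Lambda}I_r$ is a $(1-\beta p,C_{rp},0)$-strongly regular domain for some $C_{rp}>0$, and such that every $Q\in\mathcal P$ with $Q\subset\Omega$ satisfies $Q\subset I_r$ for some $r\in\Lambda$. Let $N=\sup_{P\in\mathcal H}\#\{r\in\Lambda:P\subset J_r\}$ and suppose $$C_f=N^{1/p'}C_{rp}^{1/p}\sup_{r\in\Lambda}\Theta_r<\infty,$$ where $1/p+1/p'=1$ and $N^{1/p'}:=1$ when $p=1$ (even if $N=\infty$). Then every $\mathcal B^s_{p,q}(I,m,\mathcal P)$-representation of every function in $\mathcal B^s_{p,q}(I,m,\mathcal P)$ has a $C_{GSR}C_f$-regular slicing.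
   Context: Grids. Let $(X,\nu)$ be a measure space with $\nu(X)=1$; write $|A|=\nu(A)$. A grid on $X$ is a sequence $\mathcal P=(\mathcal P^k)_{k\ge0}$ of finite families of measurable sets of positive measure, at least one nonempty, with $\sup_k\sup_{Q\in\mathcal P^k}\#\{P\in\mathcal P^k:P\cap Q\ne\emptyset\}<\infty$. For $0<c_1<c_2<1$ it is a good grid if moreover: $\mathcal P^0=\{X\}$; for each $k$ the sets of $\mathcal P^k$ are pairwise disjoint and cover $X$ up to a null set; each $Q\in\mathcal P^k$, $k\ge1$, is contained in some $P\in\mathcal P^{k-1}$; $c_1\le |Q|/|P|\le c_2$ whenever $Q\in\mathcal P^{k+1}$, $P\in\mathcal P^k$, $Q\subset P$; and $\bigcup_k\mathcal P^k$ generates the $\sigma$-algebra. Write $Q\in\mathcal P$ for $Q\in\bigcup_k\mathcal P^k$, and $k_0(\Omega,\mathcal P)=\min\{k\ge0:\exists P\in\mathcal P^k,\ P\subset\Omega\}$. Besov spaces. For $Q\in\mathcal P$ and $\sigma>0$ let $a^\sigma_Q=|Q|^{\sigma-1/p}1_Q$ and $a_Q:=a^s_Q$. For coefficients $(d_Q)$ let $\|(d_Q)\|_{p,q}=\big(\sum_k(\sum_{Q\in\mathcal P^k}|d_Q|^p)^{q/p}\big)^{1/q}$ ($\sup_k$ if $q=\infty$). A $\mathcal B^\sigma_{p,q}(X,\nu,\mathcal P)$-representation of $f\in L^p(\nu)$ is an expansion $f=\sum_k\sum_{Q\in\mathcal P^k}d_Qa^\sigma_Q$, $d_Q\in\mathbb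 C$, with $\sum_k|\sum_{Q\in\mathcal P^k}d_Qa^\sigma_Q|_{L^p}<\infty$ and $\|(d_Q)\|_{p,q}<\infty$; $\mathcal B^\sigma_{p,q}(X,\nu,\mathcal P)$ is the space of such $f$ with norm $\inf\|(d_Q)\|_{p,q}$ (same definition for a grid on a subset). For $W\in\mathcal P$, $|g|_{\mathcal B^\sigma_{p,q}(W)}$ is the infimum of $\|(d_Q)\|_{p,q}$ over representations of $g$ using only sets $Q\subset W$. Regular domain. $\Omega\subset J$ is an $(\alpha,C,\lambda)$-regular domain in $(J,\mathcal H)$ if there are families $\mathcal F^k(\Omega)\subset\mathcal H^k$, $k\ge k_0(\Omega,\mathcal H)$, all of whose members are pairwise disjoint, with union $\Omega$, and $\sum_{Q\in\mathcal F^k(\Omega)}|Q|^\alpha\le C\lambda^{k-k_0(\Omega,\mathcal H)}|\Omega|^\alpha$. Strongly regular domain. $\Omega\subset I$ is an $(\alpha,C,t)$-strongly regular domain (w.r.t. $\mathcal P$) if for each $Q\in\mathcal P^i$ with $i\ge t$ there are families $\mathcal F^k(Q\cap\Omega)\subset\mathcal P^k$, $k\ge k_0(Q\cap\Omega,\mathcal P)$, all of whose members are pairwise disjoint, with union $Q\cap\Omega$, and $\sum_{P\in\mathcal F^k(Q\cap\Omega)}|P|^\alpha\le C|Q|^\alpha$ for every $k$. Branch. For measurable $\hat J\subset J$, $\hat I\subset I$, a $(s,p,a,\tilde\epsilon,C_{DGD1},C_{DGD2},C_{DC1},C_{DC2},\mathcal G)$-branch ($C_{DGD2},C_{DC2}\in(0,1)$)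 is a bijection $h:\hat J\to\hat I$ with $h,h^{-1}$ measurable, $\mathcal G$ a grid on $(\hat I,m)$, with: (I) $m(Q)=0$ iff $\mu(h^{-1}Q)=0$; (II) for $Q\in\mathcal G$, $h^{-1}(Q)$ is a $(1-sp,C_{DGD1},C_{DGD2})$-regular domain in $(J,\mathcal H)$; (III) for $Q\in\mathcal G$, $|k_0(Q,\mathcal G)-k_0(h^{-1}Q,\mathcal H)|\ge a$ and $(|Q|/|h^{-1}Q|)^{\tilde\epsilon/|\tilde\epsilon|}\le C_{DC1}C_{DC2}^{|k_0(Q,\mathcal G)-k_0(h^{-1}Q,\mathcal H)|}$; (IV) $\hat I$ is up to a null set a countable union of elements of $\mathcal P$; (V) for $W\in\mathcal G$, $W\subset\hat I$, $h^{-1}(W)$ is up to a null set a countable union of elements of $\mathcal H$. Regular potential. $g:\hat J\to\mathbb C$ is a $(C_{DRP},\beta,\tilde\epsilon)$-regular potential for $h$ if $|g1_W|_{\mathcal B^\beta_{p,q}(W)}\le C_{DRP}(|Q|/|h^{-1}Q|)^{1/p-s+\tilde\epsilon}|W|^{1/p-\beta}$ for all $W\in\mathcal H$, $Q\in\mathcal G$ with $W\subset\hat J$, $Q\subset\hat I$, $h(W)\subset Q$. Standing assumptions. $(I,m,\mathcal P)$ and $(J,\mu,\mathcal H)$ are probability spaces with good grids; $p\in[1,\infty)$, $q\in[1,\infty]$, $\epsilon>0$, $\gamma\in[0,1]$, $s,\beta,\delta>0$ with $s+\epsilon\le1/p$, $s<\beta<1/p$, $0<\delta<\max\{s,\epsilon\}$;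 $t_0=p/(1-sp+\delta p)$. $\Lambda\subset\mathbb N$; for $r\in\Lambda$, $I_r\subset I$, $J_r\subset J$ measurable, $h_r:J_r\to I_r$ a $(s,p,a_r,\epsilon_r,C^r_{DGD1},C^r_{DGD2},C^r_{DC1},C^r_{DC2},\mathcal G_r)$-branch with $|\epsilon_r|=\epsilon$, $g_r:J_r\to\mathbb C$ a $(C^r_{DRP},\beta,\epsilon_r)$-regular potential for $h_r$. The family $\{Q\in\mathcal G_r:Q\subset I_r,r\in\Lambda\}\cup\{Q\in\mathcal P:Q\cap I_r=\emptyset\ \forall r\}$ generates the $\sigma$-algebra of $I$. $C^r_{DRS2}=\max\{(C^r_{DC2})^\epsilon,(C^r_{DGD2})^{1/p}\}$, $\sup_rC^r_{DRS2}<1$. $\Theta_r=(C^r_{DC1})^\epsilon C^r_{DRP}(C^r_{DGD1})^{1/p}(C^r_{DRS2})^{a_r(1-\gamma)}$. $\Phi_r f(x)=g_r(x)f(h_r(x))$ on $J_r$, $0$ elsewhere; $\Phi=\sum_r\Phi_r$; there is $C\ge0$ with $\sum_r|\Phi_rf|_{L^1(\mu)}\le C|f|_{L^{t_0}(m)}$ for $f\in L^{t_0}(m)$. Assumption PLAIN: for every $r\in\Lambda$ and $k$, $\mathcal G_r^k=\{P\in\mathcal P^k:P\subset I_r\}$. Regular slicing. With $N$ and $N^{1/p'}$ as in the claim: for $C_{DRS1}\ge0$, a $\mathcal B^s_{p,q}(I,m,\mathcal P)$-representation $f=\sum_k\sum_{Q\in\mathcal P^k}d_Qa_Q$ has a $C_{DRS1}$-regular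 slicing if for every $r\in\Lambda$ there is a $\mathcal B^s_{p,q}(I_r,m,\mathcal G_r)$-representation $f1_{I_r}=\sum_j\sum_{Q\in\mathcal G_r^j,Q\subset I_r}c^r_Qa_Q$ such that either (S1) $\Big(\sum_j\big(\sum_r\Theta_r(\sum_{Q\in\mathcal G_r^j,Q\subset I_r}|c^r_Q|^p)^{1/p}\big)^q\Big)^{1/q}\le C_{DRS1}\|(d_Q)\|_{p,q}$, or (S2) $N^{1/p'}\Big(\sum_j\big(\sum_r\Theta_r^p\sum_{Q\in\mathcal G_r^j,Q\subset I_r}|c^r_Q|^p\big)^{q/p}\Big)^{1/q}\le C_{DRS1}\|(d_Q)\|_{p,q}$, and such that, if $d_Q\ge0$ for all $Q$, the $c^r_Q$ can be chosen $\ge0$. *)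

(* Defs.v *)
From HB Require Import structures.
From mathcomp Require Import all_boot all_order all_algebra.
From mathcomp Require Import complex.
From mathcomp Require Import all_classical all_reals all_analysis.

Set Implicit Arguments.
Unset Strict Implicit.
Unset Printing Implicit Defensive.

Import Order.TTheory GRing.Theory Num.Theory.
Local Open Scope classical_set_scope.
Local Open Scope ring_scope.
Local Open Scope complex_scope.

Section Defs.
Context {R : realType}.

Definition cabs (z : R[i]) : R := Normc.normc z.

Definition nat_dist (a b : nat) : nat := (a - b + (b - a))%N.

Definition lq_norm (q : \bar R) (u : nat -> \bar R) : \bar R :=
  match q with
  | q'%:E => ((\sum_(k <oo) (u k `^ q')) `^ q'^-1)%E
  | +oo%E => ereal_sup (range u)
  | -oo%E => +oo%E
  end.

Section Grids.
Context {T : Type}.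

(** a grid is represented as a sequence (indexed by the level k) of finite
    families of sets; each family is a duplicate-free list *)
Definition in_grid (G : nat -> seq (set T)) (Q : set T) : Prop :=
  exists k, Q \in G k.

Definition restr_grid (G : nat -> seq (set T)) (W : set T) : nat -> seq (set T) :=
  fun k => [seq Q <- G k | `[< Q `<=` W >]].

Definition k0_pred (G : nat -> seq (set T)) (O : set T) : pred nat :=
  fun k => `[< exists2 Q, Q \in G k & Q `<=` O >].

Definition k0 (G : nat -> seq (set T)) (O : set T) : nat :=
  match pselect (exists k, k0_pred G O k) with
  | left h => ex_minn h
  | right _ => 0%N
  end.

Definition decomposition (G : nat -> seq (set T)) (O : set T)
    (F : nat -> seq (set T)) : Prop :=
  [/\ forall k, uniq (F k),
      forall k, {subset F k <= G k},
      forall k, (k < k0 G O)%N -> F k = [::],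
      forall k k' A B, A \in F k -> B \in F k' -> (k, A) <> (k', B) ->
        A `&` B = set0 &
      \bigcup_k \bigcup_(A in [set A | A \in F k]) A = O ].
End Grids.

Section Space.
Context {d} {T : measurableType d} (mu : {measure set T -> \bar R}).

Definition msr (A : set T) : R := fine (mu A).

Definition Lpnorm (p : R) (f : T -> R[i]) : \bar R :=
  Lnorm mu p%:E (fun x => (cabs (f x))%:E).

Definition cmeasurable (D : set T) (f : T -> R[i]) : Prop :=
  measurable_fun D (fun x => complex.Re (f x)) /\ measurable_fun D (fun x => complex.Im (f x)).

Definition inLp (p : R) (f : T -> R[i]) : Prop :=
  cmeasurable setT f /\ (Lpnorm p f < +oo)%E.

Definition grid_on (X : set T) (G : nat -> seq (set T)) : Prop :=
  [/\ forall k, uniq (G k),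
      forall k Q, Q \in G k -> [/\ measurable Q, Q `<=` X & (0 < mu Q)%E],
      exists k, G k != [::] &
      exists M : nat, forall k Q, Q \in G k ->
        (size [seq P <- G k | `[< P `&` Q !=set0 >]] <= M)%N ].

Definition good_grid (G : nat -> seq (set T)) : Prop :=
  grid_on setT G /\
  exists c1 c2 : R, [/\ 0 < c1, c1 < c2, c2 < 1,
    G 0%N = [:: setT] &
    [/\ forall k P Q, P \in G k -> Q \in G k -> P != Q -> P `&` Q = set0,
        forall k, mu (~` \bigcup_(Q in [set Q | Q \in G k]) Q) = 0%E,
        forall k Q, Q \in G k.+1 -> exists2 P, P \in G k & Q `<=` P,
        forall k P Q, Q \in G k.+1 -> P \in G k -> Q `<=` P ->
          c1 <= msr Q / msr P <= c2 &
        <<s \bigcup_k [set Q | Q \in G k] >> = measurable ] ].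

Definition regular_domain (H : nat -> seq (set T)) (alpha C lambda : R)
    (O : set T) : Prop :=
  exists F, decomposition H O F /\
    forall k, (k0 H O <= k)%N ->
      \sum_(Q <- F k) (msr Q `^ alpha) <=
        C * lambda ^+ (k - k0 H O) * (msr O `^ alpha).

Definition strongly_regular (P : nat -> seq (set T)) (alpha C : R) (t : nat)
    (O : set T) : Prop :=
  forall i Q, (t <= i)%N -> Q \in P i ->
    exists F, decomposition P (Q `&` O) F /\
      forall k, \sum_(A <- F k) (msr A `^ alpha) <= C * (msr Q `^ alpha).

Definition null_countable_union (G : nat -> seq (set T)) (X : set T) : Prop :=
  exists S : set (nat * set T),
    [/\ countable S, forall kQ, S kQ -> kQ.2 \in G kQ.1,
        mu (X `\` \bigcup_(kQ in S) kQ.2) = 0%E &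
        mu ((\bigcup_(kQ in S) kQ.2) `\` X) = 0%E ].

Definition atom (p sigma : R) (Q : set T) (x : T) : R[i] :=
  (msr Q `^ (sigma - p^-1))%:C * \1_Q x.

Definition level_sum (p sigma : R) (G : nat -> seq (set T))
    (dd : nat -> set T -> R[i]) (k : nat) (x : T) : R[i] :=
  \sum_(Q <- G k) dd k Q * atom p sigma Q x.

Definition level_lp (p : R) (G : nat -> seq (set T))
    (dd : nat -> set T -> R[i]) (k : nat) : R :=
  (\sum_(Q <- G k) (cabs (dd k Q) `^ p)) `^ p^-1.

Definition coef_norm (p : R) (q : \bar R) (G : nat -> seq (set T))
    (dd : nat -> set T -> R[i]) : \bar R :=
  lq_norm q (fun k => (level_lp p G dd k)%:E).

Definition besov_rep (p : R) (q : \bar R) (sigma : R) (G : nat -> seq (set T))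
    (f : T -> R[i]) (dd : nat -> set T -> R[i]) : Prop :=
  [/\ inLp p f,
      (\sum_(k <oo) Lpnorm p (level_sum p sigma G dd k) < +oo)%E,
      (fun n => Lpnorm p (fun x => f x - \sum_(k < n) level_sum p sigma G dd k x))
         @ \oo --> 0%E &
      (coef_norm p q G dd < +oo)%E ].

Definition besov_loc (p : R) (q : \bar R) (sigma : R) (G : nat -> seq (set T))
    (W : set T) (g : T -> R[i]) : \bar R :=
  ereal_inf [set coef_norm p q (restr_grid G W) dd |
              dd in [set dd | besov_rep p q sigma (restr_grid G W) g dd]].
End Space.

Section Branch.
Context {dI dJ} {I : measurableType dI} {J : measurableType dJ}
  (m : {measure set I -> \bar R}) (mu : {measure set J -> \bar R})
  (P : nat -> seq (set I)) (H : nat -> seq (set J)).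

Definition hpre (Jh : set J) (h : J -> I) (Q : set I) : set J := Jh `&` h @^-1` Q.

Definition branch (s p : R) (a : nat) (eps CDGD1 CDGD2 CDC1 CDC2 : R)
    (G : nat -> seq (set I)) (Jh : set J) (Ih : set I) (h : J -> I) : Prop :=
  [/\ set_bij Jh Ih h /\ measurable_fun Jh h /\
        (exists hinv : I -> J, [/\ measurable_fun Ih hinv,
           forall x, Jh x -> hinv (h x) = x & forall y, Ih y -> h (hinv y) = y]),
      grid_on m Ih G /\ 0 < CDGD2 < 1 /\ 0 < CDC2 < 1,
      (forall Q, measurable Q -> Q `<=` Ih -> (m Q = 0%E <-> mu (hpre Jh h Q) = 0%E)),
      (forall Q, in_grid G Q -> regular_domain mu H (1 - s * p) CDGD1 CDGD2 (hpre Jh h Q)) &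
      [/\
        (forall Q, in_grid G Q ->
           (a <= nat_dist (k0 G Q) (k0 H (hpre Jh h Q)))%N /\
           (msr m Q / msr mu (hpre Jh h Q)) `^ (eps / `|eps|) <=
             CDC1 * CDC2 ^+ nat_dist (k0 G Q) (k0 H (hpre Jh h Q))),
        null_countable_union m P Ih &
        (forall W, in_grid G W -> W `<=` Ih -> null_countable_union mu H (hpre Jh h W))]].

Definition regular_potential (p : R) (q : \bar R) (s beta eps CDRP : R)
    (G : nat -> seq (set I)) (Jh : set J) (Ih : set I) (h : J -> I)
    (g : J -> R[i]) : Prop :=
  forall W Q, in_grid H W -> in_grid G Q -> W `<=` Jh -> Q `<=` Ih -> h @` W `<=` Q ->
    (besov_loc mu p q beta H W (fun x => (g x * \1_W x)%R) <=
      (CDRP * (msr m Q / msr mu (hpre Jh h Q)) `^ (p^-1 - s + eps)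
            * (msr mu W `^ (p^-1 - beta)))%:E)%E.

Definition Phi_comp (Jh : set J) (h : J -> I) (g : J -> R[i]) (f : I -> R[i]) : J -> R[i] :=
  fun x => g x * f (h x) * \1_Jh x.
End Branch.

Definition CDRS2 (p eps CDC2 CDGD2 : R) : R :=
  Num.max (CDC2 `^ eps) (CDGD2 `^ p^-1).

Definition Theta (p eps gam : R) (a : nat) (CDGD1 CDGD2 CDC1 CDC2 CDRP : R) : R :=
  CDC1 `^ eps * CDRP * CDGD1 `^ p^-1
    * CDRS2 p eps CDC2 CDGD2 `^ (a%:R * (1 - gam)).

Definition Ncount {T : Type} (H : nat -> seq (set T)) (Lam : set nat)
    (Jr : nat -> set T) : \bar R :=
  ereal_sup [set \esum_(r in [set r | Lam r /\ W `<=` Jr r]) 1%E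
            | W in [set W | in_grid H W]].

Definition Npow (p : R) (N : \bar R) : \bar R :=
  if p == 1 then 1%E else (N `^ (1 - p^-1))%E.

Definition regular_slicing {dI} {I : measurableType dI}
    (m : {measure set I -> \bar R}) (P : nat -> seq (set I))
    (G : nat -> nat -> seq (set I)) (Lam : set nat) (Ir : nat -> set I)
    (Th : nat -> R) (Np : \bar R) (p : R) (q : \bar R) (s : R)
    (CDRS1 : R) (f : I -> R[i]) (dd : nat -> set I -> R[i]) : Prop :=
  exists c : nat -> nat -> set I -> R[i],
    [/\ forall r, Lam r ->
          besov_rep m p q s (restr_grid (G r) (Ir r)) (fun x => f x * \1_(Ir r) x) (c r),
        (lq_norm q (fun j => \esum_(r in Lam)
             (Th r * level_lp p (restr_grid (G r) (Ir r)) (c r) j)%:E)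
           <= CDRS1%:E * coef_norm p q P dd)%E
        \/
        (Np * lq_norm q (fun j => (\esum_(r in Lam)
             (Th r `^ p * \sum_(Q <- restr_grid (G r) (Ir r) j) (cabs (c r j Q) `^ p))%:E)
             `^ p^-1)
           <= CDRS1%:E * coef_norm p q P dd)%E &
        (forall k Q, Q \in P k -> 0 <= dd k Q) ->
          forall r j Q, Lam r -> Q \in restr_grid (G r) (Ir r) j -> 0 <= c r j Q ].
End Defs.

(* Main.v *)
Require Import Defs.
From HB Require Import structures.
From mathcomp Require Import all_boot all_order all_algebra.
From mathcomp Require Import complex.
From mathcomp Require Import all_classical all_reals all_analysis.
From mathcomp Require Import measurable_realfun ring.
Set Implicit Arguments.
Unset Strict Implicit.
Unset Printing Implicit Defensive.
Import Order.TTheory GRing.Theory Num.Theory.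
Local Open Scope classical_set_scope.
Local Open Scope ring_scope.

(** Restrict a cell [Q] to [Om], the union of the [I_r]: by strong regularity
    [Q] meets [Om] in the disjoint cells [A] of the families [F^j(Q)], and on each of them
    [a_Q = (|A| / |Q|) ^ (1/p - s) a_A].  Summing over [Q] gives coefficients [c_A] for
    [f 1_Om], one and the same family for all [r], since each [A] lies in a single [I_r].
    Cells shrink at least by the factor [c = c_2 < 1] per level, so writing
    [1 - s p = (1 - beta p) + (beta - s) p] shows that level [k] of [f] contributes to level
    [j >= k] at most [C_rp ^ (1/p) rho ^ (j - k)] times its l^p norm, [rho = c ^ (beta - s)].
    Young's inequality for the geometric kernel gives the bound with
    [C_GSR = 1 / (1 - rho)], and alternative (S2) follows. *)

(** * Inequalities for sums of powers and for [l^q] norms *)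

(** The bound on the transferred coefficients does not by itself make them a representation of
    [f 1_{I_r}]: they regroup a double family, indexed by the level [k] of [Q] and the level [j] of
    [A], and [L^p] convergence of the new partial sums needs its own argument. Cutting off at [n]
    leaves two errors: that of the given representation of [f], and, for each [Q] of level [k < n],
    the part of [Q] inside [Om] not yet reached by families of level below [n]. Since
    [|A| = |A| ^ (1 - beta p) |A| ^ (beta p)], that part has measure at most a constant times
    [c ^ (beta p (n - k)) |Q|]; its [L^p] contribution is of order [c ^ (s n) rho ^ (n - k)], which
    sums over [k] to [O(c ^ (s n))]. As a cell inside [Om] lies in one [I_r], no cell of the
    families is cut by another [I_r], and a sum over [r] counts each cell at most once. Hence only
    the supremum of [Theta_r] enters the estimate. *)

Lemma powRV (R : realType) (x p : R) : 0 <= x -> x^-1 `^ p = (x `^ p)^-1.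
Proof. by move=> x0; rewrite -powR_inv1 // -powRrM mulN1r powRN. Qed.

Lemma powR_exprn (R : realType) (x r : R) n : 0 <= x -> (x ^+ n) `^ r = (x `^ r) ^+ n.
Proof.
by move=> x0; rewrite -!powR_mulrn ?powR_ge0 // -!powRrM mulrC.
Qed.

Lemma powR_invK (R : realType) (x r : R) : 0 <= x -> 0 < r -> (x `^ r) `^ r^-1 = x.
Proof. by move=> x0 r0; rewrite -powRrM mulfV ?gt_eqF // powRr1. Qed.

Lemma le_powR (R : realType) (r x y : R) : 0 <= r -> 0 <= x -> x <= y -> x `^ r <= y `^ r.
Proof.
by move=> r0 x0 xy; apply: ge0_ler_powR; rewrite ?nnegrE // (le_trans x0).
Qed.

Lemma le_poweR (R : realType) (r : R) (x y : \bar R) :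
  0 <= r -> (0 <= x)%E -> (x <= y)%E -> (x `^ r <= y `^ r)%E.
Proof.
move=> r0 x0 xy; apply: gt0_ler_poweR => //; rewrite in_itv /= leey ?x0 //.
by rewrite (le_trans x0).
Qed.

Lemma powR_convex2 (R : realType) (p w1 w2 x y : R) :
  1 <= p -> 0 <= w1 -> 0 <= w2 -> w1 + w2 = 1 -> 0 <= x -> 0 <= y ->
  (w1 * x + w2 * y) `^ p <= w1 * x `^ p + w2 * y `^ p.
Proof.
move=> p1 w10 w20 w12 x0 y0.
have w11 : w1 <= 1 by rewrite -w12 lerDl.
have w2E : w2 = 1 - w1 by rewrite -w12; ring.
have := @convex_powR R p p1 (Itv01 w10 w11) x y.
rewrite !inE /= !in_itv /= !andbT => /(_ x0 y0).
by rewrite !convRE /= w2E.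
Qed.

Lemma sum_powR_le0_eq0 (R : realType) (S : eqType) (s : seq S) (f : S -> R) (p : R) :
  0 < p -> (forall i, 0 <= f i) -> \sum_(i <- s) f i `^ p <= 0 ->
  forall i, i \in s -> f i = 0.
Proof.
move=> p0 f0 sle i si.
have : \sum_(i <- s) f i `^ p == 0.
  by rewrite eq_le sle sumr_ge0 // => j _; apply: powR_ge0.
rewrite psumr_eq0 => [/allP /(_ i si)|j _]; last exact: powR_ge0.
by rewrite powR_eq0 => /andP[/eqP].
Qed.

(* Dividing [f] and [g] by the bounds [A] and [B] reduces the triangle inequality to
   convexity of the p-th power with weights A / (A + B) and B / (A + B). *)
Lemma sum_powR_minkowski2 (R : realType) (S : eqType) (s : seq S) (f g : S -> R)
    (p A B : R) :
  1 <= p -> (forall i, 0 <= f i) -> (forall i, 0 <= g i) -> 0 <= A -> 0 <= B ->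
  \sum_(i <- s) f i `^ p <= A `^ p -> \sum_(i <- s) g i `^ p <= B `^ p ->
  \sum_(i <- s) (f i + g i) `^ p <= (A + B) `^ p.
Proof.
move=> p1 f0 g0 A0 B0 fA gB.
have p0 : 0 < p by apply: lt_le_trans p1.
have [A00|A00] := eqVneq A 0.
  move: fA; rewrite A00 powR0 ?gt_eqF // => /(sum_powR_le0_eq0 p0 f0) fz.
  rewrite add0r (le_trans _ gB) // le_eqVlt; apply/orP; left; apply/eqP.
  by apply: eq_big_seq => i /fz ->; rewrite add0r.
have [B00|B00] := eqVneq B 0.
  move: gB; rewrite B00 powR0 ?gt_eqF // => /(sum_powR_le0_eq0 p0 g0) gz.
  rewrite addr0 (le_trans _ fA) // le_eqVlt; apply/orP; left; apply/eqP.
  by apply: eq_big_seq => i /gz ->; rewrite addr0.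
have Ap : 0 < A by rewrite lt_neqAle eq_sym A00.
have Bp : 0 < B by rewrite lt_neqAle eq_sym B00.
have Sp : 0 < A + B by apply: addr_gt0.
have S0 := ltW Sp.
have Apn : A `^ p != 0 by rewrite gt_eqF ?powR_gt0.
have Bpn : B `^ p != 0 by rewrite gt_eqF ?powR_gt0.
pose w1 := A / (A + B); pose w2 := B / (A + B).
have w10 : 0 <= w1 by rewrite divr_ge0 // ltW.
have w20 : 0 <= w2 by rewrite divr_ge0 // ltW.
have w12 : w1 + w2 = 1 by rewrite -mulrDl divff ?gt_eqF.
have le1 i : (f i + g i) `^ p <=
    (A + B) `^ p * (w1 * (f i `^ p / A `^ p) + w2 * (g i `^ p / B `^ p)).
  have -> : f i + g i = (A + B) * (w1 * (f i / A) + w2 * (g i / B)).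
    by rewrite /w1 /w2; field; rewrite A00 B00 gt_eqF.
  rewrite powRM ?addr_ge0 ?mulr_ge0 ?divr_ge0 ?invr_ge0 //.
  rewrite ler_wpM2l ?powR_ge0 //.
  apply: le_trans (powR_convex2 p1 w10 w20 w12 _ _) _; rewrite ?divr_ge0 //.
  by rewrite !powRM ?invr_ge0 // !powRV.
apply: (@le_trans _ _ (\sum_(i <- s)
    (A + B) `^ p * (w1 * (f i `^ p / A `^ p) + w2 * (g i `^ p / B `^ p)))).
  by apply: ler_sum => i _; exact: le1.
rewrite -mulr_sumr -[leRHS]mulr1 ler_wpM2l ?powR_ge0 // big_split /=.
rewrite -!mulr_sumr -!mulr_suml -w12 lerD //.
  by rewrite -[leRHS]mulr1 ler_wpM2l // ler_pdivrMr ?mul1r // powR_gt0.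
by rewrite -[leRHS]mulr1 ler_wpM2l // ler_pdivrMr ?mul1r // powR_gt0.
Qed.

(** Stated with bounds [B k] in place of norms, so that no p-th root has to be taken during the
    induction. *)
Lemma sum_powR_minkowski (R : realType) (S : eqType) (s : seq S) (f : nat -> S -> R)
    (B : nat -> R) (p : R) (n : nat) :
  1 <= p -> (forall k i, 0 <= f k i) -> (forall k, 0 <= B k) ->
  (forall k, (k < n)%N -> \sum_(i <- s) f k i `^ p <= B k `^ p) ->
  \sum_(i <- s) (\sum_(k < n) f k i) `^ p <= (\sum_(k < n) B k) `^ p.
Proof.
move=> p1 f0 B0; elim: n => [|n IH] fB.
  rewrite big_ord0 big1 ?powR_ge0 // => i _.
  by rewrite big_ord0 powR0 // gt_eqF // (lt_le_trans ltr01).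
rewrite big_ord_recr /=; under eq_bigr do rewrite big_ord_recr /=.
apply: sum_powR_minkowski2 => //; try by move=> *; apply: sumr_ge0.
  by apply: IH => k kn; apply: fB; apply: ltnW.
exact: fB.
Qed.

Lemma geometric_sum_le (R : realType) (z : R) (n : nat) : 0 <= z -> z < 1 ->
  \sum_(i < n) z ^+ i <= (1 - z)^-1.
Proof.
move=> z0 z1.
rewrite -[leRHS]mul1r ler_pdivlMr ?subr_gt0 // mulrC -opprB mulNr -subrX1 opprB.
by rewrite gerBl exprn_ge0.
Qed.

Lemma lq_norm_ge0 (R : realType) (q : \bar R) (u : nat -> \bar R) :
  (forall k, 0 <= u k)%E -> (0 <= lq_norm q u)%E.
Proof.
move=> u0; case: q => [q||] //=; first exact: poweR_ge0.
by apply: le_trans (u0 0%N) _; apply: ereal_sup_ubound; exists 0%N.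
Qed.

Lemma le_lq_norm (R : realType) (q : \bar R) (u v : nat -> \bar R) :
  (1 <= q)%E -> (forall k, 0 <= u k)%E -> (forall k, u k <= v k)%E ->
  (lq_norm q u <= lq_norm q v)%E.
Proof.
move=> q1 u0 uv; case: q q1 => [q||] //= q1.
  have q0 : (0 <= q) by rewrite -lee_fin (le_trans _ q1).
  apply: le_poweR; first by rewrite invr_ge0.
    by apply: nneseries_ge0 => *; apply: poweR_ge0.
  apply: lee_nneseries => [i _ _|i _]; first exact: poweR_ge0.
  exact: le_poweR.
apply: ge_ereal_sup => _ [k _ <-]; apply: le_trans (uv k) _.
by apply: ereal_sup_ubound; exists k.
Qed.

(** Trades the extended-real norm for inequalities between finite real sums, to which Minkowski's
    inequality applies. *)
Lemma lq_norm_sum_le (R : realType) (q : R) (u : nat -> R) (M : R) :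
  1 <= q -> (forall k, 0 <= u k) -> 0 <= M ->
  (lq_norm q%:E (fun k => (u k)%:E) <= M%:E)%E <->
  forall n, \sum_(k < n) u k `^ q <= M `^ q.
Proof.
move=> q1 u0 M0; have q0 : 0 < q by apply: lt_le_trans q1.
have S0 : (0 <= \sum_(k <oo) (u k)%:E `^ q)%E.
  by apply: nneseries_ge0 => *; apply: poweR_ge0.
have -> : (lq_norm q%:E (fun k => (u k)%:E) <= M%:E)%E =
          (\sum_(k <oo) (u k)%:E `^ q <= (M `^ q)%:E)%E.
  rewrite /lq_norm; apply/idP/idP => h.
    rewrite -[leLHS]poweRe1 // -(mulVf (lt0r_neq0 q0)) poweRrM -poweR_EFin.
    by apply: le_poweR h; rewrite ?poweR_ge0 ?ltW.
  have -> : M%:E = ((M `^ q)%:E `^ q^-1)%E.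
    by rewrite poweR_EFin powR_invK.
  by apply: le_poweR => //; rewrite invr_ge0 ltW.
split=> h.
  move=> n; rewrite -lee_fin (le_trans _ h) // -sumEFin.
  rewrite -(big_mkord xpredT (fun k => (u k `^ q)%:E)).
  under eq_bigr do rewrite -poweR_EFin.
  by apply: nneseries_lim_ge => *; apply: poweR_ge0.
apply: lime_le; first by apply: is_cvg_nneseries => *; apply: poweR_ge0.
apply: nearW => n; under eq_bigr do rewrite poweR_EFin.
by rewrite sumEFin lee_fin big_mkord.
Qed.

Lemma coord_le_lq_norm (R : realType) (q : \bar R) (u : nat -> R) (k : nat) :
  (1 <= q)%E -> (forall k, 0 <= u k) ->
  ((u k)%:E <= lq_norm q (fun k => (u k)%:E))%E.
Proof.
move=> q1 u0; have N0 : (0 <= lq_norm q (fun k => (u k)%:E))%E.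
  by apply: lq_norm_ge0 => i; rewrite lee_fin.
case: q q1 N0 => [q||] // q1 N0; last by apply: ereal_sup_ubound; exists k.
case E : (lq_norm _ _) N0 => [M||] //; rewrite ?leey // lee_fin => M0.
have q0 : 0 < q by rewrite -lte_fin (lt_le_trans _ q1).
have /lq_norm_sum_le : (lq_norm q%:E (fun k => (u k)%:E) <= M%:E)%E by rewrite E.
rewrite -lee_fin => /(_ q1 u0 M0 k.+1); rewrite big_ord_recr /= => h.
rewrite lee_fin -(powR_invK (u0 k) q0) -[leRHS](powR_invK M0 q0).
apply: le_powR; rewrite ?invr_ge0 ?(ltW q0) ?powR_ge0 //.
by apply: le_trans h; rewrite lerDr sumr_ge0 // => i _; apply: powR_ge0.
Qed.

(* Minkowski's inequality for the shifts of [L], the [i]-th one having weight [z ^+ i]. *)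
Lemma lq_norm_geometric_convolution (R : realType) (q : \bar R) (K z : R) (L u : nat -> R) :
  (1 <= q)%E -> 0 <= K -> 0 <= z -> z < 1 -> (forall k, 0 <= L k) ->
  (lq_norm q (fun k => (L k)%:E) < +oo)%E -> (forall k, 0 <= u k) ->
  (forall j, u j <= K * \sum_(i < j.+1) z ^+ i * L (j - i)%N) ->
  (lq_norm q (fun k => (u k)%:E) <=
     (K / (1 - z))%:E * lq_norm q (fun k => (L k)%:E))%E.
Proof.
move=> q1 K0 z0 z1 L0 Lfin u0 uL.
have N0 : (0 <= lq_norm q (fun k => (L k)%:E))%E.
  by apply: lq_norm_ge0 => i; rewrite lee_fin.
have zi0 : 0 <= (1 - z)^-1 by rewrite invr_ge0 subr_ge0 ltW.
have LN k := @coord_le_lq_norm R q L k q1 L0.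
case E : (lq_norm q (fun k => (L k)%:E)) N0 Lfin => [M||] // M0 _.
rewrite lee_fin in M0; rewrite -EFinM.
have LM k : L k <= M by move: (LN k); rewrite E lee_fin.
case: q q1 E LN => [q||] // q1 E LN; last first.
  (* For [q = +oo] every [L k] is at most [M], and only the kernel has to be summed. *)
  apply: ge_ereal_sup => _ [j _ <-]; rewrite lee_fin.
  apply: le_trans (uL j) _; rewrite -mulrA ler_wpM2l //.
  apply: le_trans (ler_wpM2r M0 (geometric_sum_le j.+1 z0 z1)).
  by rewrite mulr_suml; apply: ler_sum => i _; rewrite ler_wpM2l ?exprn_ge0.
have q0 : 0 < q by rewrite -lte_fin (lt_le_trans _ q1).
have LS : forall n, \sum_(k < n) L k `^ q <= M `^ q.
  by apply/lq_norm_sum_le => //; rewrite E.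
apply/lq_norm_sum_le => //; first by rewrite !mulr_ge0.
move=> n.
(* The [i]-th shift of [L], extended by 0: the triangular sum over [i <= j] becomes a sum over all
   [i < n], to which Minkowski's inequality in the index [j] applies with the bounds [B i]. *)
pose c i j := if (i <= j)%N then L (j - i)%N else 0.
have c0 i j : 0 <= c i j by rewrite /c; case: ifP.
pose b i j := K * (z ^+ i * c i j).
have b0 i j : 0 <= b i j by rewrite /b !mulr_ge0 ?exprn_ge0.
pose B i := K * (z ^+ i * M).
have B0 i : 0 <= B i by rewrite /B !mulr_ge0 ?exprn_ge0.
have step j : (j < n)%N -> u j <= \sum_(i < n) b i j.
  move=> jn; apply: le_trans (uL j) _; rewrite /b -mulr_sumr ler_wpM2l //.
  rewrite (big_ord_widen_cond n xpredT (fun i => z ^+ i * L (j - i)%N)) //=.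
  rewrite big_mkcond /=; apply: ler_sum => i _.
  by rewrite ltnS /c; case: ifP; rewrite ?mulr0.
apply: (@le_trans _ _ (\sum_(j <- index_iota 0 n) (\sum_(i < n) b i j) `^ q)).
  rewrite big_mkord; apply: ler_sum => j _.
  by apply: le_powR; rewrite ?(ltW q0) ?step.
apply: (@le_trans _ _ ((\sum_(i < n) B i) `^ q)).
  apply: sum_powR_minkowski => // i _.
  rewrite big_mkord /b /B !powRM ?mulr_ge0 ?exprn_ge0 //.
  under eq_bigr do rewrite !powRM ?mulr_ge0 ?exprn_ge0 //.
  rewrite -!mulr_sumr ler_wpM2l ?powR_ge0 // ler_wpM2l ?powR_ge0 //.
  apply: le_trans (LS (n - i)%N).
  rewrite -(big_mkord xpredT (fun k => L k `^ q)).
  rewrite -(big_mkord xpredT (fun j => c i j `^ q)) /c.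
  (* The shift vanishes below index [i]; the remaining indices give the first [n - i] terms of
     [L]. *)
  have [ni|lt] := leqP n i.
    rewrite big_nat_cond big1 => [|j /andP[/andP[_ jn] _]]; last first.
      by rewrite leqNgt (leq_trans jn ni) /= powR0 ?lt0r_neq0.
    by apply: sumr_ge0 => k _; apply: powR_ge0.
  rewrite (@big_cat_nat _ _ _ i) //=; last exact: ltnW.
  rewrite big_nat_cond big1 ?add0r => [|j /andP[/andP[_ ji] _]]; last first.
    by rewrite leqNgt ji /= powR0 ?lt0r_neq0.
  rewrite -{1}(add0n i) big_addn; apply: ler_sum => k _.
  by rewrite leq_addl addnK.
apply: le_powR; rewrite ?(ltW q0) ?sumr_ge0 //.
rewrite /B -mulr_sumr -mulr_suml -mulrA ler_wpM2l // ler_wpM2r //.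
exact: geometric_sum_le.
Qed.

(** * Complex-valued functions and sums over disjoint cells *)

Section ComplexModulus.
Local Open Scope complex_scope.
Variable R : realType.
Implicit Types x y : R[i].

Lemma cabs_ge0 x : 0 <= cabs x.
Proof. by case: x => a b; rewrite /cabs /= sqrtr_ge0. Qed.

Lemma cabs0 : cabs (0 : R[i]) = 0.
Proof. by rewrite /cabs Normc.normc0. Qed.

Lemma cabsM x y : cabs (x * y) = cabs x * cabs y.
Proof. exact: Normc.normcM. Qed.

Lemma cabs_real (r : R) : 0 <= r -> cabs r%:C = r.
Proof. by move=> r0; rewrite /cabs /= expr0n addr0 sqrtr_sqr ger0_norm. Qed.

Lemma le_cabsD x y : cabs (x + y) <= cabs x + cabs y.
Proof. exact: le_normcD. Qed.

Lemma le_cabs_sum (S : Type) (s : seq S) (F : S -> R[i]) :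
  cabs (\sum_(i <- s) F i) <= \sum_(i <- s) cabs (F i).
Proof.
elim: s => [|i s IH]; first by rewrite !big_nil cabs0.
by rewrite !big_cons (le_trans (le_cabsD _ _)) // lerD2l.
Qed.

Lemma Re_sum (S : Type) (s : seq S) (F : S -> R[i]) :
  complex.Re (\sum_(i <- s) F i) = \sum_(i <- s) complex.Re (F i).
Proof. exact: (@raddf_sum _ _ (@complex.Re R : Rcomplex R -> R)). Qed.

Lemma Im_sum (S : Type) (s : seq S) (F : S -> R[i]) :
  complex.Im (\sum_(i <- s) F i) = \sum_(i <- s) complex.Im (F i).
Proof. exact: (@raddf_sum _ _ (@complex.Im R : Rcomplex R -> R)). Qed.

End ComplexModulus.

Section ComplexMeasurable.
Local Open Scope complex_scope.
Context {R : realType} d {T : measurableType d}.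
Implicit Types f g : T -> R[i].

Lemma cmeasurable_cabs f : cmeasurable setT f ->
  measurable_fun setT (fun x => cabs (f x)).
Proof.
move=> [fR fI].
have -> : (fun x => cabs (f x)) =
    (fun x => (complex.Re (f x) ^+ 2 + complex.Im (f x) ^+ 2) `^ 2^-1).
  apply/funext => x; rewrite powR12_sqrt ?addr_ge0 ?sqr_ge0 //.
  by case: (f x).
apply: (measurableT_comp (measurable_powR _)).
by apply: measurable_funD; apply: measurable_funX.
Qed.

Lemma cmeasurable_sum (S : Type) (s : seq S) (F : S -> T -> R[i]) :
  (forall i, cmeasurable setT (F i)) ->
  cmeasurable setT (fun x => \sum_(i <- s) F i x).
Proof.
move=> mF; split.
  under eq_fun do rewrite Re_sum.
  by apply: measurable_sum => i; case: (mF i).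
under eq_fun do rewrite Im_sum.
by apply: measurable_sum => i; case: (mF i).
Qed.

Lemma cmeasurableB f g : cmeasurable setT f -> cmeasurable setT g ->
  cmeasurable setT (fun x => f x - g x).
Proof.
move=> [fR fI] [gR gI]; split.
  rewrite (_ : (fun x => complex.Re (f x - g x)) =
              (fun x => complex.Re (f x) - complex.Re (g x))).
    exact: measurable_funB.
  by apply/funext => x; case: (f x) => ? ?; case: (g x).
rewrite (_ : (fun x => complex.Im (f x - g x)) =
              (fun x => complex.Im (f x) - complex.Im (g x))).
  exact: measurable_funB.
by apply/funext => x; case: (f x) => ? ?; case: (g x).
Qed.

Lemma indicC (A : set T) x : (\1_A x : R[i]) = (\1_A x : R)%:C.
Proof. by rewrite !indicE; case: (_ \in _). Qed.

Lemma cmeasurable_indicM f (A : set T) : cmeasurable setT f -> measurable A ->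
  cmeasurable setT (fun x => f x * \1_A x).
Proof.
move=> [fR fI] mA.
have mi : measurable_fun setT (\1_A : T -> R) by apply: measurable_indic.
split.
  rewrite (_ : (fun x => complex.Re _) = (fun x => complex.Re (f x) * \1_A x)).
    exact: measurable_funM.
  apply/funext => x; rewrite indicC; case: (f x) => u v /=.
  by rewrite mulr0 subr0.
rewrite (_ : (fun x => complex.Im _) = (fun x => complex.Im (f x) * \1_A x)).
  exact: measurable_funM.
apply/funext => x; rewrite indicC; case: (f x) => u v /=.
by rewrite mulr0 add0r.
Qed.

Lemma cmeasurable_cstM_indic (v : R[i]) (A : set T) : measurable A ->
  cmeasurable setT (fun x => v * \1_A x).
Proof. by apply: cmeasurable_indicM; split; apply: measurable_cst. Qed.

End ComplexMeasurable.

Section DisjointSums.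
Context {T : Type}.

Definition disjoint_cells (s : seq (set T)) :=
  forall A B, A \in s -> B \in s -> A != B -> A `&` B = set0.

Lemma disjoint_cells_eq (s : seq (set T)) A B x :
  disjoint_cells s -> A \in s -> B \in s -> A x -> B x -> A = B.
Proof.
move=> ds As Bs Ax Bx; apply/eqP/negP => /negP /(ds _ _ As Bs) AB.
by have : (A `&` B) x by []; rewrite AB.
Qed.

(** Evaluates a step function at [x]. The weight [w] is abstract, so that complex values, their p-th
    powers and transferred coefficients are treated alike. *)
Lemma sum_disjoint_cells (V : nmodType) (s : seq (set T)) (w : set T -> V) A x :
  uniq s -> disjoint_cells s -> A \in s -> A x ->
  (forall B, B \in s -> ~ B x -> w B = 0) ->
  \sum_(B <- s) w B = w A.
Proof.
move=> us ds As Ax w0; rewrite (bigD1_seq A) //=.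
rewrite big_seq_cond big1 ?addr0 // => B /andP[Bs BA]; apply: w0 => // Bx.
by move/eqP: BA; apply; exact: disjoint_cells_eq Bs As Bx Ax.
Qed.

Lemma sum_disjoint_cells0 (V : nmodType) (s : seq (set T)) (w : set T -> V) x :
  (forall A, A \in s -> ~ A x) -> (forall B, B \in s -> ~ B x -> w B = 0) ->
  \sum_(B <- s) w B = 0.
Proof. by move=> nx w0; rewrite big_seq big1 // => B Bs; apply: w0 => //; apply: nx. Qed.

End DisjointSums.

(** * [L^p] norms of complex functions and of step functions *)

Section LpNorms.
Local Open Scope complex_scope.
Context {R : realType} d {T : measurableType d} (m : probability T R).
Implicit Types f g : T -> R[i].

Lemma measurable_abse_poweR (p : R) (u : T -> R) : measurable_fun setT u ->
  measurable_fun setT (fun x => `|(u x)%:E| `^ p)%E.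
Proof.
move=> mu; apply: (measurableT_comp (measurable_poweR _)).
by apply: measurableT_comp => //; apply/measurable_EFinP.
Qed.

Lemma le_Lpnorm p f g : 0 < p -> cmeasurable setT f -> cmeasurable setT g ->
  (forall x, cabs (f x) <= cabs (g x)) -> (Lpnorm m p f <= Lpnorm m p g)%E.
Proof.
move=> p0 mf mg fg; rewrite /Lpnorm unlock.
apply: le_poweR; first by rewrite invr_ge0 ltW.
  by apply: integral_ge0 => x _; apply: poweR_ge0.
apply: ge0_le_integral => //.
- by move=> x _; apply: poweR_ge0.
- by apply: measurable_abse_poweR; exact: cmeasurable_cabs.
- by apply: measurable_abse_poweR; exact: cmeasurable_cabs.
- move=> x _; apply: le_poweR; [exact: ltW|exact: abse_ge0|].
  by rewrite /= lee_fin !ger0_norm ?cabs_ge0.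
Qed.

Lemma LpnormD p f g : 1 <= p -> cmeasurable setT f -> cmeasurable setT g ->
  cmeasurable setT (fun x => f x + g x) ->
  (Lpnorm m p (fun x => f x + g x)%R <= Lpnorm m p f + Lpnorm m p g)%E.
Proof.
move=> p1 mf mg mfg.
have := minkowski_EFin m (cmeasurable_cabs mf) (cmeasurable_cabs mg) p1.
apply: le_trans; rewrite /Lpnorm unlock.
have p0 : 0 < p by apply: lt_le_trans p1.
apply: le_poweR; first by rewrite invr_ge0 ltW.
  by apply: integral_ge0 => x _; apply: poweR_ge0.
apply: ge0_le_integral => //.
- by move=> x _; apply: poweR_ge0.
- by apply: measurable_abse_poweR; exact: cmeasurable_cabs.
- apply: measurable_abse_poweR.
  by apply: measurable_funD; exact: cmeasurable_cabs.
- move=> x _; apply: le_poweR; [exact: ltW|exact: abse_ge0|].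
  by rewrite /= lee_fin !ger0_norm ?addr_ge0 ?cabs_ge0 // le_cabsD.
Qed.

Lemma Lpnorm_sum p n (F : nat -> T -> R[i]) : 1 <= p ->
  (forall k, cmeasurable setT (F k)) ->
  (Lpnorm m p (fun x => \sum_(k < n) F k x)%R <= \sum_(k < n) Lpnorm m p (F k))%E.
Proof.
move=> p1 mF; elim: n => [|n IH].
  under eq_fun do rewrite big_ord0.
  rewrite big_ord0 /Lpnorm; under eq_fun do rewrite cabs0.
  by rewrite Lnorm0 // eqe gt_eqF // (lt_le_trans ltr01).
rewrite big_ord_recr /=; under eq_fun do rewrite big_ord_recr /=.
have mS k : cmeasurable setT (fun x => \sum_(i < k) F i x).
  by apply: cmeasurable_sum.
apply: le_trans (leeD2r _ IH).
apply: LpnormD => //; first exact: mS.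
rewrite (_ : (fun x => _) = (fun x => \sum_(i < n.+1) F i x)); first exact: mS.
by apply/funext => x; rewrite big_ord_recr.
Qed.

(** At each point at most one term is nonzero, so the p-th power of the modulus passes inside the
    sum. The subsets [U A] serve both for full cells and for their uncovered remainders. *)
Lemma Lpnorm_disjoint_cells p (s : seq (set T)) (U : set T -> set T)
    (v : set T -> R[i]) :
  0 < p -> uniq s -> disjoint_cells s ->
  (forall A, A \in s -> measurable (U A)) -> (forall A, A \in s -> U A `<=` A) ->
  Lpnorm m p (fun x => \sum_(A <- s) v A * \1_(U A) x) =
    ((\sum_(A <- s) cabs (v A) `^ p * msr m (U A)) `^ p^-1)%:E.
Proof.
move=> p0 us ds mU UA; rewrite /Lpnorm unlock -poweR_EFin; congr (_ `^ _)%E.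
(* Set to 0 off [s], because [U A] is known to be measurable only for [A] in [s]. *)
pose F A x : R := if A \in s then cabs (v A) `^ p * \1_(U A) x else 0.
rewrite (eq_integral (fun x => (\sum_(A <- s) F A x)%:E)); last first.
  move=> x _; rewrite poweR_EFin ger0_norm ?cabs_ge0 //.
  have [[A [As Ax]]|nx] := pselect (exists A, A \in s /\ A x).
    rewrite (sum_disjoint_cells us ds As Ax); last first.
      by move=> B Bs Bx; rewrite indicE memNset ?mulr0 // => /(UA _ Bs)/Bx.
    rewrite (sum_disjoint_cells us ds As Ax); last first.
      by move=> B Bs Bx; rewrite /F Bs indicE memNset ?mulr0 // => /(UA _ Bs)/Bx.
    rewrite /F As; congr EFin; rewrite cabsM powRM ?cabs_ge0 //; congr (_ * _).
    rewrite indicC cabs_real ?indicE //.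
    by case: (_ \in _); rewrite ?powR1 ?powR0 ?gt_eqF.
  rewrite (@sum_disjoint_cells0 _ _ _ _ x); first last.
  - by move=> B Bs Bx; rewrite indicE memNset ?mulr0 // => /(UA _ Bs)/Bx.
  - by move=> A As Ax; apply: nx; exists A.
  rewrite (@sum_disjoint_cells0 _ _ _ _ x); first last.
  - by move=> B Bs Bx; rewrite /F Bs indicE memNset ?mulr0 // => /(UA _ Bs)/Bx.
  - by move=> A As Ax; apply: nx; exists A.
  by rewrite cabs0 powR0 ?gt_eqF.
under eq_integral do rewrite -sumEFin.
rewrite ge0_integral_sum //; first last.
- move=> A x _; rewrite /F; case: ifP => // _.
  by rewrite lee_fin mulr_ge0 ?powR_ge0 // indicE.
- move=> A; rewrite /F; case: (boolP (A \in s)) => As; last exact: measurable_cst.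
  apply/measurable_EFinP; apply: measurable_funM; first exact: measurable_cst.
  by apply: measurable_indic; exact: mU.
rewrite -sumEFin; apply: eq_big_seq => A As; under eq_integral do rewrite /F As.
under eq_integral do rewrite EFinM.
rewrite ge0_integralZl_EFin ?powR_ge0 //; last first.
  by apply/measurable_EFinP; apply: measurable_indic; exact: mU.
rewrite integral_indic ?setIT //; last exact: mU.
by rewrite EFinM /msr fineK // fin_num_measure //; exact: mU.
Qed.

End LpNorms.

(** * Cells of a good grid and the transferred coefficients *)

Section Cells.
Context {R : realType} d {T : measurableType d} (m : probability T R).

Definition cell_tree (c : R) (P : nat -> seq (set T)) : Prop :=
  [/\ forall k, uniq (P k),
      forall k, disjoint_cells (P k),
      forall k Q, Q \in P k -> [/\ measurable Q, 0 < msr m Q & msr m Q <= 1] &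
      forall k Q, Q \in P k.+1 ->
        exists2 A, A \in P k & Q `<=` A /\ msr m Q <= c * msr m A].

Lemma msr_gt0 (A : set T) : measurable A -> (0 < m A)%E -> 0 < msr m A.
Proof.
move=> mA A0; rewrite /msr -lte_fin fineK // fin_num_measure //.
Qed.

Lemma msr_le1 (A : set T) : measurable A -> msr m A <= 1.
Proof.
by move=> mA; rewrite /msr -lee_fin fineK ?fin_num_measure // probability_le1.
Qed.

Lemma msrK (A : set T) : measurable A -> (msr m A)%:E = m A.
Proof. by move=> mA; rewrite /msr fineK // fin_num_measure. Qed.

Lemma le_msr (A B : set T) : measurable A -> measurable B -> A `<=` B ->
  msr m A <= msr m B.
Proof. by move=> mA mB AB; rewrite -lee_fin !msrK // le_measure ?inE. Qed.

Lemma good_grid_cell_tree (P : nat -> seq (set T)) : good_grid m P ->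
  exists c : R, [/\ 0 < c, c < 1 & cell_tree c P].
Proof.
move=> [[uP mP _ _] [c1 [c2 [c10 c12 c21 P0 [dP _ nP rP _]]]]].
have mc2 k Q : Q \in P k -> [/\ measurable Q, 0 < msr m Q & msr m Q <= 1].
  by move=> /mP [mQ _ Q0]; split => //; [exact: msr_gt0|exact: msr_le1].
exists c2; split => //; first exact: lt_trans c12.
split => // k Q Qk.
have [A Ak QA] := nP _ _ Qk; exists A => //; split => //.
have [_ A0 _] := mc2 _ _ Ak.
by have /andP[_] := rP _ _ _ Qk Ak QA; rewrite ler_pdivrMr.
Qed.

Variables (c : R) (P : nat -> seq (set T)).
Hypotheses (c0 : 0 < c) (c1 : c < 1) (ctP : cell_tree c P).

Lemma cell_measurable k Q : Q \in P k -> measurable Q.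
Proof. by case: ctP => _ _ h _ /h []. Qed.

Lemma cell_msr_gt0 k Q : Q \in P k -> 0 < msr m Q.
Proof. by case: ctP => _ _ h _ /h []. Qed.

Lemma cell_uniq k : uniq (P k).
Proof. by case: ctP. Qed.

Lemma cell_disjoint k : disjoint_cells (P k).
Proof. by case: ctP. Qed.

Lemma cell_nonempty k Q : Q \in P k -> exists x, Q x.
Proof.
move=> Qk; apply/set0P/negP => /eqP Q0.
by have := cell_msr_gt0 Qk; rewrite Q0 /msr measure0 ltxx.
Qed.

Lemma cell_ancestor k i A : A \in P (k + i)%N ->
  exists2 B, B \in P k & A `<=` B /\ msr m A <= c ^+ i * msr m B.
Proof.
elim: i A => [|i IH] A.
  by rewrite addn0 => Ak; exists A => //; rewrite expr0 mul1r; split.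
rewrite addnS; case: ctP => _ _ _ h /h [B /IH [D Dk [BD mBD]] [AB mAB]].
exists D => //; split; first exact: subset_trans BD.
by apply: le_trans mAB _; rewrite exprS -mulrA ler_pM2l.
Qed.

(** For [k <= j] the ancestor of [A] at level [k] shares a point with [Q], hence is [Q]. If [j < k],
    the ancestor of [Q] at level [j] is likewise [A], and [|A| <= |Q| <= c ^ (k - j) |A| < |A|] is
    absurd. *)
Lemma cell_level j k A Q : A \in P j -> Q \in P k -> A `<=` Q ->
  (k <= j)%N /\ msr m A <= c ^+ (j - k) * msr m Q.
Proof.
move=> Aj Qk AQ; have [x Ax] := cell_nonempty Aj.
have [kj|jk] := leqP k j.
  split=> //; move: (Aj); rewrite -{1}(subnKC kj) => /cell_ancestor [B Bk [AB mAB]].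
  by rewrite (disjoint_cells_eq (@cell_disjoint k) Qk Bk (AQ _ Ax) (AB _ Ax)).
move: (Qk); rewrite -{1}(subnKC (ltnW jk)) => /cell_ancestor [B Bj [QB mQB]].
have AB := disjoint_cells_eq (@cell_disjoint j) Aj Bj Ax (QB _ (AQ _ Ax)).
have A0 := cell_msr_gt0 Aj.
suff : msr m A < msr m A by rewrite ltxx.
apply: le_lt_trans (le_msr (cell_measurable Aj) (cell_measurable Qk) AQ) _.
rewrite -AB in mQB; apply: le_lt_trans mQB _.
by rewrite -[ltRHS]mul1r ltr_pM2r // exprn_ilt1 ?ltW // -lt0n subn_gt0.
Qed.

Lemma cell_msr_le k Q : Q \in P k -> msr m Q <= c ^+ k.
Proof.
rewrite -{1}(add0n k) => /cell_ancestor [B B0 [_ /le_trans]]; apply.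
rewrite -[leRHS]mulr1 ler_wpM2l ?exprn_ge0 ?(ltW c0) //.
by case: ctP => _ _ h _; case: (h _ _ B0).
Qed.

End Cells.

(** * Coefficients transferred to the cells inside [Om] *)

Section Transfer.
Local Open Scope complex_scope.
Context {R : realType} d {T : measurableType d} (m : probability T R).
Variables (c : R) (P : nat -> seq (set T)).
Hypotheses (c0 : 0 < c) (c1 : c < 1) (ctP : cell_tree m c P).
Variables (p s beta C : R).
Hypotheses (p1 : 1 <= p) (s0 : 0 < s) (sbeta : s < beta).
Hypothesis (C0 : 0 <= C).
Variables (Om : set T) (F : nat -> set T -> nat -> seq (set T)).
Hypothesis decF : forall k Q, Q \in P k -> decomposition P (Q `&` Om) (F k Q).
Hypothesis sumF : forall k Q j, Q \in P k ->
  \sum_(A <- F k Q j) msr m A `^ (1 - beta * p) <= C * msr m Q `^ (1 - beta * p).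
Variable dd : nat -> set T -> R[i].

Let p0 : 0 < p. Proof. exact: lt_le_trans p1. Qed.

Let rho := c `^ (beta - s).

Lemma powR_lt1 (r : R) : 0 < r -> c `^ r < 1.
Proof.
move=> r0; rewrite /powR gt_eqF // expR_lt1 // pmulr_rlt0 //.
exact: ln_lt0 (introT andP (conj c0 c1)).
Qed.

Lemma decomposition_sub k Q j A : Q \in P k -> A \in F k Q j ->
  A \in P j /\ A `<=` Q `&` Om.
Proof.
move=> /decF [_ FP _ _ UF] AF; split; first exact: FP.
by rewrite -UF => x Ax; exists j => //; exists A.
Qed.

Lemma decomposition_level k Q j A : Q \in P k -> A \in F k Q j ->
  (k <= j)%N /\ msr m A <= c ^+ (j - k) * msr m Q.
Proof.
move=> Qk AF; have [Aj AQ] := decomposition_sub Qk AF.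
by apply: (cell_level c0 c1 ctP) => // x /AQ [].
Qed.

(* The part of the coefficient of [A] (at level [j]) coming from the level [k] of the
   representation of [f]: the cell [Q] at level [k] restricted to [Om] splits into the
   cells of [F k Q], and [a_Q = (|A| / |Q|) ^ (1/p - s) a_A] on such a cell [A]. *)
Definition transfer_level k j A : R[i] :=
  \sum_(Q <- P k) if A \in F k Q j
                  then dd k Q * ((msr m A / msr m Q) `^ (p^-1 - s))%:C else 0.

(** A cell of [F k Q j] is contained in [Q], hence has level [j >= k]: the finite sum over [k <= j]
    is the whole coefficient. *)
Definition transfer j A : R[i] := \sum_(k < j.+1) transfer_level k j A.

Lemma transfer_ge0 : (forall k Q, Q \in P k -> 0 <= dd k Q) ->
  forall j A, 0 <= transfer j A.
Proof.
move=> dd0 j A; apply: sumr_ge0 => k _; rewrite /transfer_level big_seq.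
apply: sumr_ge0 => Q Qk; case: ifP => // _; rewrite mulr_ge0 ?dd0 //.
by rewrite lecR powR_ge0.
Qed.

(** The cell [A] lies in at most one [Q] of level [k], so the sum has at most one nonzero term and
    the p-th power acts on it alone. *)
Lemma transfer_level_powR k j A : A \in P j ->
  cabs (transfer_level k j A) `^ p <=
  \sum_(Q <- P k) if A \in F k Q j
    then cabs (dd k Q) `^ p * (msr m A / msr m Q) `^ (1 - s * p) else 0.
Proof.
move=> Aj; have [x Ax] := cell_nonempty ctP Aj.
have [[Q [Qk AQ]]|nQ] := pselect (exists Q, Q \in P k /\ A \in F k Q j); last first.
  rewrite /transfer_level big_seq big1; last first.
    by move=> Q Qk; case: ifP => // AQ; case: nQ; exists Q.
  rewrite cabs0 powR0 ?gt_eqF // sumr_ge0 // => Q _.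
  by case: ifP => // _; rewrite mulr_ge0 ?powR_ge0.
have sub B : B \in P k -> ~ B x -> A \in F k B j = false.
  by move=> Bk Bx; apply/negP => /(decomposition_sub Bk)[_ /(_ _ Ax)[]].
have Qx : Q x by have [_ /(_ _ Ax)[]] := decomposition_sub Qk AQ.
rewrite /transfer_level.
rewrite (sum_disjoint_cells (cell_uniq ctP k) (cell_disjoint ctP (k:=k)) Qk Qx); last first.
  by move=> B Bk Bx; rewrite sub.
rewrite (sum_disjoint_cells (cell_uniq ctP k) (cell_disjoint ctP (k:=k)) Qk Qx); last first.
  by move=> B Bk Bx; rewrite sub.
rewrite AQ cabsM cabs_real ?powR_ge0 // powRM ?cabs_ge0 ?powR_ge0 //.
by rewrite -powRrM mulrBl mulVf ?lt0r_neq0.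
Qed.

(** After an exchange of sums one cell [Q] is treated at a time: strong regularity bounds the sum of
    [(|A| / |Q|) ^ (1 - beta p)] by [C], and the leftover exponent [(beta - s) p], positive, turns
    [|A| <= c ^ (j - k) |Q|] into decay. *)
Lemma transfer_level_sum k j : (k <= j)%N ->
  \sum_(A <- P j) cabs (transfer_level k j A) `^ p <=
  (C `^ p^-1 * (rho ^+ (j - k) * level_lp p P dd k)) `^ p.
Proof.
move=> kj; set S := \sum_(Q <- P k) cabs (dd k Q) `^ p.
have S0 : 0 <= S by apply: sumr_ge0 => *; apply: powR_ge0.
have -> : (C `^ p^-1 * (rho ^+ (j - k) * level_lp p P dd k)) `^ p =
          C * (c ^+ (j - k)) `^ ((beta - s) * p) * S.
  rewrite !powRM ?mulr_ge0 ?exprn_ge0 ?powR_ge0 //.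
  rewrite /level_lp -!powRrM mulVf ?lt0r_neq0 // !powRr1 // mulrA.
  congr (_ * _ * _); rewrite -powR_mulrn ?powR_ge0 // -powRrM.
  by rewrite -powR_mulrn ?ltW // -!powRrM mulrCA !mulrA [_ * (beta - s)]mulrC.
apply: (@le_trans _ _ (\sum_(A <- P j) \sum_(Q <- P k) if A \in F k Q j
    then cabs (dd k Q) `^ p * (msr m A / msr m Q) `^ (1 - s * p) else 0)).
  by rewrite big_seq [leRHS]big_seq; apply: ler_sum => A Aj; apply: transfer_level_powR.
rewrite exchange_big /= /S mulr_sumr big_seq [leRHS]big_seq.
apply: ler_sum => Q Qk; rewrite -big_mkcond /= -mulr_sumr mulrC ler_wpM2r ?powR_ge0 //.
have Q0 := cell_msr_gt0 ctP Qk.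
have [uF FP _ _ _] := decF Qk.
rewrite -big_filter (perm_big (F k Q j)) /=; last first.
  apply: uniq_perm; rewrite ?filter_uniq ?(cell_uniq ctP) // => A.
  by rewrite mem_filter andbC; apply/andP/idP => [[]|AF] //; split => //; apply: FP.
apply: (@le_trans _ _ (\sum_(A <- F k Q j) (msr m A `^ (1 - beta * p) *
   (msr m Q `^ (1 - beta * p))^-1 * (c ^+ (j - k)) `^ ((beta - s) * p)))).
  rewrite big_seq [leRHS]big_seq; apply: ler_sum => A AF.
  have [Aj _] := decomposition_sub Qk AF; have A0 := cell_msr_gt0 ctP Aj.
  have [_ lev] := decomposition_level Qk AF.
  have -> : 1 - s * p = (1 - beta * p) + (beta - s) * p by ring.
  rewrite powRD; last by apply/implyP => _; rewrite gt_eqF // divr_gt0.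
  rewrite powRM ?invr_ge0 ?(ltW A0) ?(ltW Q0) // powRV ?(ltW Q0) //.
  rewrite ler_wpM2l ?mulr_ge0 ?invr_ge0 ?powR_ge0 // le_powR //.
  - by rewrite mulr_ge0 ?(ltW p0) // subr_ge0 ltW.
  - by rewrite divr_ge0 ?ltW.
  - by rewrite ler_pdivrMr.
rewrite -!mulr_suml ler_wpM2r ?powR_ge0 // ler_pdivrMr ?powR_gt0 //.
exact: sumF.
Qed.

(** Minkowski's inequality over the contributing levels [k]; with [i = j - k] the bound becomes a
    convolution with the kernel [rho ^ i]. *)
Lemma level_lp_transfer j :
  level_lp p P transfer j <=
  C `^ p^-1 * \sum_(i < j.+1) rho ^+ i * level_lp p P dd (j - i)%N.
Proof.
have L0 k : 0 <= level_lp p P dd k by apply: powR_ge0.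
have B0 k : 0 <= C `^ p^-1 * (rho ^+ (j - k) * level_lp p P dd k).
  by rewrite !mulr_ge0 ?exprn_ge0 ?powR_ge0.
have -> : C `^ p^-1 * (\sum_(i < j.+1) rho ^+ i * level_lp p P dd (j - i)%N) =
    \sum_(k < j.+1) C `^ p^-1 * (rho ^+ (j - k) * level_lp p P dd k).
  rewrite mulr_sumr.
  rewrite [RHS](reindex_inj (@rev_ord_inj j.+1)).
  apply: eq_bigr => i _.
  rewrite (_ : rev_ord i = j - i :> nat)%N; last by rewrite /= subSS.
  by rewrite (subKn (leq_ord i)).
rewrite -[leRHS](powR_invK _ p0) ?sumr_ge0 //.
apply: le_powR; first by rewrite invr_ge0 ltW.
  by apply: sumr_ge0 => *; apply: powR_ge0.
apply: (@le_trans _ _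
    (\sum_(A <- P j) (\sum_(k < j.+1) cabs (transfer_level k j A)) `^ p)).
  apply: ler_sum => A _; apply: le_powR; rewrite ?(ltW p0) ?cabs_ge0 //.
  exact: le_cabs_sum.
apply: (sum_powR_minkowski (f := fun k A => cabs (transfer_level k j A))
  (B := fun k => C `^ p^-1 * (rho ^+ (j - k) * level_lp p P dd k))) => //.
  by move=> *; apply: cabs_ge0.
by move=> k; rewrite ltnS; apply: transfer_level_sum.
Qed.

Lemma coef_norm_transfer (q : \bar R) : (1 <= q)%E ->
  (coef_norm p q P dd < +oo)%E ->
  (coef_norm p q P transfer <=
    (C `^ p^-1 / (1 - rho))%:E * coef_norm p q P dd)%E.
Proof.
move=> q1 dfin; apply: lq_norm_geometric_convolution => //.
- exact: powR_ge0.
- exact: powR_ge0.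
- by apply: powR_lt1; rewrite subr_gt0.
- by move=> k; apply: powR_ge0.
- by move=> k; apply: powR_ge0.
- exact: level_lp_transfer.
Qed.

(** * Measure of the part of a cell not yet covered *)

Definition cover (l : seq (set T)) : set T := \bigcup_(A in [set A | A \in l]) A.

Lemma cover_measurable (l : seq (set T)) :
  (forall A, A \in l -> measurable A) -> measurable (cover l).
Proof.
by move=> ml; apply: fin_bigcup_measurable => //; exact: finite_seq.
Qed.

Lemma measure_cover_le (l : seq (set T)) : (forall A, A \in l -> measurable A) ->
  (m (cover l) <= (\sum_(A <- l) msr m A)%:E)%E.
Proof.
elim: l => [|A l IH] ml.
  rewrite big_nil /cover (_ : \bigcup_(A in _) A = set0) ?measure0 //.
  by rewrite -subset0 => x [].
have mA : measurable A by apply: ml; rewrite mem_head.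
have ml' B : B \in l -> measurable B by move=> Bs; apply: ml; rewrite inE Bs orbT.
have -> : cover (A :: l) = A `|` cover l.
  apply/seteqP; split=> [x [B /=]|x [Ax|[B Bs Bx]]].
  - by rewrite inE => /predU1P[->|Bs] Bx; [left|right; exists B].
  - by exists A => //=; rewrite mem_head.
  - by exists B => //=; rewrite inE [B \in l]Bs orbT.
apply: le_trans (measureU2 _ mA (cover_measurable ml')) _.
by rewrite big_cons EFinD msrK // leeD2l // IH.
Qed.

Let tau := c `^ (beta * p).

Let tau_lt1 : tau < 1.
Proof. by apply: powR_lt1; rewrite mulr_gt0 // (lt_trans s0). Qed.

Lemma decomposition_measurable k Q j : Q \in P k ->
  forall A, A \in F k Q j -> measurable A.
Proof.
by move=> Qk A /(decomposition_sub Qk)[/(cell_measurable ctP)].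
Qed.

(** In [|A| = |A| ^ (1 - beta p) |A| ^ (beta p)] strong regularity sums the first factor, and the
    level difference bounds the second. *)
Lemma measure_cover_decomposition k Q j : Q \in P k -> (k <= j)%N ->
  (m (cover (F k Q j)) <= (C * msr m Q * tau ^+ (j - k))%:E)%E.
Proof.
move=> Qk kj; apply: le_trans (measure_cover_le (decomposition_measurable Qk)) _.
have Q0 := cell_msr_gt0 ctP Qk; have bp0 : 0 <= beta * p.
  by rewrite mulr_ge0 ?ltW // (lt_trans s0).
rewrite lee_fin; apply: (@le_trans _ _
  (\sum_(A <- F k Q j) msr m A `^ (1 - beta * p) * (c ^+ (j - k) * msr m Q) `^ (beta * p))).
  rewrite big_seq [leRHS]big_seq; apply: ler_sum => A AF.
  have [Aj _] := decomposition_sub Qk AF; have A0 := cell_msr_gt0 ctP Aj.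
  have [_ lev] := decomposition_level Qk AF.
  rewrite -[leLHS]powRr1 ?(ltW A0) // -{1}(subrK (beta * p) 1) powRD.
    by rewrite ler_wpM2l ?powR_ge0 // le_powR // ltW.
  by apply/implyP => _; rewrite gt_eqF.
rewrite -mulr_suml; apply: le_trans (ler_wpM2r (powR_ge0 _ _) (sumF j Qk)) _.
rewrite powRM ?exprn_ge0 ?(ltW c0) ?(ltW Q0) // powR_exprn ?(ltW c0) // -/tau.
have -> : C * msr m Q `^ (1 - beta * p) * (tau ^+ (j - k) * msr m Q `^ (beta * p)) =
   C * (msr m Q `^ (1 - beta * p) * msr m Q `^ (beta * p)) * tau ^+ (j - k) by ring.
rewrite -powRD; last by apply/implyP => _; rewrite gt_eqF.
by rewrite subrK powRr1 // ltW.
Qed.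

(** The set on which the contribution of [Q] is still missing when the transferred expansion is cut
    off at level [n]. *)
Definition remainder k Q n : set T :=
  (Q `&` Om) `\` \bigcup_(j in `I_n) cover (F k Q j).

Lemma decomposition_cover k Q : Q \in P k ->
  \bigcup_j cover (F k Q j) = Q `&` Om.
Proof. by move=> /decF[]. Qed.

Lemma remainder_sub k Q n : remainder k Q n `<=` Q.
Proof. by move=> x [[]]. Qed.

Lemma remainder_measurable k Q n : Q \in P k -> measurable (remainder k Q n).
Proof.
move=> Qk; have mF j : measurable (cover (F k Q j)).
  exact: cover_measurable (decomposition_measurable Qk).
apply: measurableD.
  by rewrite -(decomposition_cover Qk); apply: bigcup_measurable => *; apply: mF.
by apply: bigcup_measurable => *; apply: mF.
Qed.

(** The remainder is contained in the covers of level at least [n], whose measures form a geometric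
    tail. *)
Lemma msr_remainder k Q n : Q \in P k -> (k <= n)%N ->
  msr m (remainder k Q n) <= C / (1 - tau) * msr m Q * tau ^+ (n - k).
Proof.
move=> Qk kn; have mR := remainder_measurable n Qk.
have Q0 := ltW (cell_msr_gt0 ctP Qk).
rewrite -lee_fin msrK //.
have mF j : measurable (cover (F k Q j)).
  exact: cover_measurable (decomposition_measurable Qk).
have sub : remainder k Q n `<=` \bigcup_(j in ~` `I_n) cover (F k Q j).
  move=> x []; rewrite -(decomposition_cover Qk) => -[j _ jx] nx.
  by exists j => //= jn; apply: nx; exists j.
apply: le_trans (measure_sigma_subadditive_tail m mF mR sub) _.
apply: lime_le; first by apply: is_cvg_nneseries.
apply: nearW => N; apply: (@le_trans _ _
  (\sum_(n <= j < N) (C * msr m Q * tau ^+ (j - k))%:E)%E).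
  rewrite big_nat_cond [leRHS]big_nat_cond; apply: lee_sum => j /andP[/andP[nj _] _].
  by apply: measure_cover_decomposition => //; apply: leq_trans nj.
rewrite sumEFin lee_fin -mulr_sumr.
rewrite (_ : C / _ * _ * _ = C * msr m Q * (tau ^+ (n - k) / (1 - tau))); last by ring.
rewrite ler_wpM2l ?mulr_ge0 //.
rewrite -{1}(add0n n) big_addn.
rewrite (eq_bigr (fun i => tau ^+ (n - k) * tau ^+ i)); last first.
  by move=> i _; rewrite -exprD [in RHS]addnC addnBA.
rewrite -mulr_sumr ler_wpM2l ?exprn_ge0 ?powR_ge0 // big_mkord.
by rewrite geometric_sum_le ?powR_ge0.
Qed.

(** * [L^p] estimates for level sums and remainders *)

Let weight k Q : R[i] := dd k Q * (msr m Q `^ (s - p^-1))%:C.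

Lemma level_sumE (G : nat -> seq (set T)) k x :
  level_sum m p s G dd k x = \sum_(Q <- G k) weight k Q * \1_Q x.
Proof. by apply: eq_bigr => Q _; rewrite /atom mulrA. Qed.

Lemma cmeasurable_cells (r : seq (set T)) (U : set T -> set T) (v : set T -> R[i]) :
  (forall A, A \in r -> measurable (U A)) ->
  cmeasurable setT (fun x => \sum_(A <- r) v A * \1_(U A) x).
Proof.
(* Off [r] the set [U A] may fail to be measurable; the empty set replaces it there without changing
   the sum. *)
move=> mU; rewrite (_ : (fun x => _) =
  (fun x => \sum_(A <- r) v A * \1_(if A \in r then U A else set0) x)).
  apply: cmeasurable_sum => A; apply: cmeasurable_cstM_indic.
  by case: ifP => [/mU|_] //; exact: measurable0.
by apply/funext => x; apply: eq_big_seq => A ->.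
Qed.

(** An atom has [L^p] norm [|Q| ^ s], and [|Q| <= c ^ k]. Bounded level norms thus make the series
    of [L^p] norms converge, whatever [q] is. *)
Lemma Lpnorm_level_sum_le (G : nat -> seq (set T)) (e : nat -> set T -> R[i]) k :
  uniq (G k) -> {subset G k <= P k} ->
  (Lpnorm m p (level_sum m p s G e k) <= ((c `^ s) ^+ k * level_lp p G e k)%:E)%E.
Proof.
move=> uG GP; rewrite /level_sum /atom.
under [X in Lpnorm _ _ X]eq_fun do under eq_bigr do rewrite mulrA.
rewrite (@Lpnorm_disjoint_cells _ _ _ m p (G k) id) //; first last.
- by move=> A _ x.
- by move=> A /GP /(cell_measurable ctP).
- by move=> A B /GP Ak /GP Bk; exact: (cell_disjoint ctP (k:=k) Ak Bk).
rewrite lee_fin.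
have ck0 : 0 <= (c `^ s) ^+ k by rewrite exprn_ge0 ?powR_ge0.
rewrite -[X in X * _](powR_invK ck0 p0) /level_lp -powRM; last 2 first.
- exact: powR_ge0.
- by apply: sumr_ge0 => *; apply: powR_ge0.
apply: le_powR; first by rewrite invr_ge0 ltW.
  by apply: sumr_ge0 => *; rewrite mulr_ge0 ?powR_ge0 // fine_ge0.
rewrite mulr_sumr big_seq [leRHS]big_seq; apply: ler_sum => Q /GP Qk.
have Q0 := cell_msr_gt0 ctP Qk.
rewrite cabsM cabs_real ?powR_ge0 // powRM ?cabs_ge0 ?powR_ge0 //.
rewrite -mulrA mulrC ler_wpM2r ?powR_ge0 //.
rewrite -powRrM -[X in _ * X]powRr1 ?(ltW Q0) // -powRD; last first.
  by apply/implyP => _; rewrite gt_eqF.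
rewrite mulrBl mulVf ?lt0r_neq0 // subrK powRrM.
apply: le_powR; rewrite ?(ltW p0) ?powR_ge0 //.
rewrite -powR_exprn ?(ltW c0) //.
apply: le_powR; rewrite ?(ltW s0) ?(ltW Q0) //; exact: (cell_msr_le c0 ctP).
Qed.

(** On one cell, [|Q| ^ (s - 1/p)] times the p-th root of the measure of the remainder is at most a
    constant times [c ^ (s k) c ^ (beta (n - k)) = c ^ (s n) rho ^ (n - k)]. *)
Lemma Lpnorm_remainder k n : (k <= n)%N ->
  (Lpnorm m p (fun x => \sum_(Q <- P k) weight k Q * \1_(remainder k Q n) x)%R <=
   ((C / (1 - tau)) `^ p^-1 * level_lp p P dd k * (c `^ s) ^+ n * rho ^+ (n - k))%:E)%E.
Proof.
move=> kn; have K0 : 0 <= C / (1 - tau) by rewrite divr_ge0 // subr_ge0 ltW.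
rewrite Lpnorm_disjoint_cells //; first last.
- by move=> Q _; apply: remainder_sub.
- by move=> Q; apply: remainder_measurable.
- exact: (cell_disjoint ctP).
- exact: (cell_uniq ctP).
rewrite lee_fin; set cs := c `^ s.
have cs0 : 0 <= cs ^+ n * rho ^+ (n - k) by rewrite mulr_ge0 // exprn_ge0 ?powR_ge0.
rewrite -mulrA -[cs ^+ n * _](powR_invK cs0 p0).
rewrite /level_lp -!powRM ?powR_ge0 ?mulr_ge0 ?sumr_ge0 ?invr_ge0 ?subr_ge0
  ?(ltW tau_lt1) //; try by move=> *; apply: powR_ge0.
apply: le_powR; first by rewrite invr_ge0 ltW.
  by apply: sumr_ge0 => *; rewrite mulr_ge0 ?powR_ge0 // fine_ge0.
rewrite mulrAC mulr_sumr big_seq [leRHS]big_seq; apply: ler_sum => Q Qk.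
have Q0 := cell_msr_gt0 ctP Qk.
rewrite cabsM cabs_real ?powR_ge0 // powRM ?cabs_ge0 ?powR_ge0 //.
rewrite -mulrA mulrC ler_wpM2r ?powR_ge0 //.
apply: le_trans (ler_wpM2l (powR_ge0 _ _) (msr_remainder Qk kn)) _.
rewrite (_ : _ `^ p * (C / (1 - tau) * msr m Q * tau ^+ (n - k)) =
  C / (1 - tau) * (((msr m Q `^ (s - p^-1)) `^ p * msr m Q) * tau ^+ (n - k))); last by ring.
rewrite ler_wpM2l //.
rewrite -powRrM -[X in _ * X * _]powRr1 ?(ltW Q0) // -powRD; last first.
  by apply/implyP => _; rewrite gt_eqF.
rewrite mulrBl mulVf ?lt0r_neq0 // subrK.
have -> : tau ^+ (n - k) = ((c `^ beta) ^+ (n - k)) `^ p.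
  by rewrite powR_exprn ?powR_ge0 // /tau powRrM.
have -> : cs ^+ n * rho ^+ (n - k) = cs ^+ k * (c `^ beta) ^+ (n - k).
  rewrite -{1}(subnKC kn) exprD -mulrA -exprMn /cs /rho -powRD.
    by rewrite addrC subrK.
  by apply/implyP => _; rewrite gt_eqF.
rewrite [leRHS]powRM ?exprn_ge0 ?powR_ge0 // ler_wpM2r ?powR_ge0 //.
rewrite powRrM; apply: le_powR; rewrite ?(ltW p0) ?powR_ge0 //.
rewrite /cs -powR_exprn ?(ltW c0) //.
apply: le_powR; rewrite ?(ltW s0) ?(ltW Q0) //; exact: (cell_msr_le c0 ctP).
Qed.

Lemma indic_cover k Q j A x : Q \in P k -> A \in P j -> A x ->
  \1_(cover (F k Q j)) x = (A \in F k Q j)%:R :> R[i].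
Proof.
move=> Qk Aj Ax; rewrite indicE; congr (nat_of_bool _)%:R.
apply/idP/idP => [|AF]; rewrite inE; last by exists A.
move=> [B BF Bx]; have [Bj _] := decomposition_sub Qk BF.
by rewrite (disjoint_cells_eq (cell_disjoint ctP (k:=j)) Aj Bj Ax Bx).
Qed.

(** The powers of [|A|] cancel, which leaves the value that the level [k] sum takes on the cell [Q]
    containing [A]. *)
Lemma transfer_level_atom k j A : A \in P j ->
  transfer_level k j A * (msr m A `^ (s - p^-1))%:C =
  \sum_(Q <- P k) weight k Q * (A \in F k Q j)%:R.
Proof.
move=> Aj; rewrite /transfer_level mulr_suml; apply: eq_big_seq => Q Qk.
case: ifP => _; last by rewrite mul0r mulr0.
have A0 := cell_msr_gt0 ctP Aj; have Q0 := cell_msr_gt0 ctP Qk.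
rewrite mulr1 /weight -mulrA -rmorphM /=; congr (_ * _%:C).
rewrite powRM ?invr_ge0 ?ltW // mulrAC powRV ?(ltW Q0) // -powRN opprB.
rewrite -powRD; last by apply/implyP => _; rewrite gt_eqF.
by rewrite addrA subrK subrr powRr0 mul1r.
Qed.

(** * The transferred coefficients represent [f 1_W] *)

Section Restriction.
Variable W : set T.
Hypotheses (mW : measurable W) (WOm : W `<=` Om).
(** A cell of [Om] that meets [W] lies in [W], so passing to the grid restricted to [W] loses no
    cell of the families that meets [W]. *)
Hypothesis catchW : forall j A x, A \in P j -> A `<=` Om -> A x -> W x -> A `<=` W.

Lemma mem_restr_grid j A :
  (A \in restr_grid P W j) = (A \in P j) && `[< A `<=` W >].
Proof. by rewrite mem_filter andbC. Qed.

(** At a point of [W] everything depends on the cell [A] of level [j] through it. If [A] lies in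
    [W], its coefficient times the height of its atom gives the sum over [k] and [Q]; otherwise
    [catchW] excludes [A] from every family and both sides vanish. *)
Lemma level_sum_transfer j x :
  level_sum m p s (restr_grid P W) transfer j x =
  (\sum_(k < j.+1) \sum_(Q <- P k) weight k Q * \1_(cover (F k Q j)) x) * \1_W x.
Proof.
rewrite /level_sum.
have atom0 A : A \in restr_grid P W j -> ~ A x -> transfer j A * atom m p s A x = 0.
  by move=> _ Ax; rewrite /atom indicE memNset // !mulr0.
have ur : uniq (restr_grid P W j) by rewrite filter_uniq ?(cell_uniq ctP).
have dr : disjoint_cells (restr_grid P W j).
  move=> A B; rewrite !mem_restr_grid => /andP[Aj _] /andP[Bj _].
  exact: (cell_disjoint ctP (k:=j)).
have [Wx|Wx] := pselect (W x); last first.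
  have -> : \1_W x = 0 :> R[i] by rewrite indicE memNset.
  rewrite mulr0 (@sum_disjoint_cells0 _ _ _ _ x) //.
  by move=> A; rewrite mem_restr_grid => /andP[_ /asboolP AW] /AW.
have -> : \1_W x = 1 :> R[i] by rewrite indicE mem_set.
rewrite mulr1.
have [[A [Aj Ax]]|nA] := pselect (exists A, A \in P j /\ A x); last first.
  rewrite (@sum_disjoint_cells0 _ _ _ _ x) //; last first.
    by move=> A; rewrite mem_restr_grid => /andP[Aj _] Ax; apply: nA; exists A.
  rewrite big1 // => k _; rewrite big_seq big1 // => Q Qk.
  rewrite indicE memNset ?mulr0 // => -[A AF Ax]; apply: nA; exists A; split=> //.
  by have [] := decomposition_sub Qk AF.
rewrite (eq_bigr (fun k : 'I_j.+1 => \sum_(Q <- P k) weight k Q * (A \in F k Q j)%:R));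
  last by move=> k _; apply: eq_big_seq => Q Qk; rewrite (indic_cover Qk Aj Ax).
have [AW|AW] := pselect (A `<=` W).
  have Ar : A \in restr_grid P W j by rewrite mem_restr_grid Aj; apply/asboolP.
  rewrite (sum_disjoint_cells ur dr Ar Ax) ; last exact: atom0.
  rewrite /atom indicE mem_set // mulr1 /transfer mulr_suml.
  by apply: eq_bigr => k _; apply: transfer_level_atom.
rewrite (@sum_disjoint_cells0 _ _ _ _ x); first last.
- exact: atom0.
- move=> B; rewrite mem_restr_grid => /andP[Bj /asboolP BW] Bx; apply: AW.
  by rewrite (disjoint_cells_eq (cell_disjoint ctP (k:=j)) Aj Bj Ax Bx).
rewrite big1 // => k _; rewrite big_seq big1 // => Q Qk.
case: (boolP (A \in F k Q j)) => [AF|_]; last by rewrite mulr0.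
case: AW; have [_ AQ] := decomposition_sub Qk AF.
by apply: catchW Aj _ Ax Wx => y /AQ [].
Qed.

Lemma cover_empty k Q j : Q \in P k -> (j < k)%N -> cover (F k Q j) = set0.
Proof.
move=> Qk jk; rewrite -subset0 => x [A AF _].
by have [] := decomposition_level Qk AF; rewrite leqNgt jk.
Qed.

(** A point of [Q] in [W] lies in the cover of exactly one level [j]; the two cases are [j < n] and
    [n <= j]. *)
Lemma indic_remainder n k Q x : Q \in P k -> W x ->
  \1_Q x - \sum_(j < n) \1_(cover (F k Q j)) x = \1_(remainder k Q n) x :> R[i].
Proof.
move=> Qk Wx; have [Qx|Qx] := pselect (Q x); last first.
  rewrite [LHS](_ : _ = 0); last first.
    rewrite indicE memNset // big1 ?subr0 // => j _; rewrite indicE memNset //.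
    by move=> [A AF Ax]; have [_ /(_ _ Ax)[]] := decomposition_sub Qk AF.
  by rewrite indicE memNset // => /remainder_sub.
have [j _ jx] : (\bigcup_j cover (F k Q j)) x.
  by rewrite (decomposition_cover Qk); split => //; exact: WOm.
have other i : i != j -> \1_(cover (F k Q i)) x = 0 :> R[i].
  move=> ij; rewrite indicE memNset // => -[A AF Ax].
  have [B BF Bx] := jx; have [_ _ _ dF _] := decF Qk.
  suff : (A `&` B) x by rewrite (dF _ _ _ _ AF BF) // => -[/eqP]; rewrite (negbTE ij).
  by [].
have -> : \1_Q x = 1 :> R[i] by rewrite indicE mem_set.
have [jn|nj] := ltnP j n.
  rewrite (bigD1 (Ordinal jn)) //= big1 => [|i ij]; last exact: other.
  have -> : \1_(cover (F k Q j)) x = 1 :> R[i] by rewrite indicE mem_set.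
  by rewrite addr0 subrr indicE memNset // => -[_]; apply; exists j.
rewrite big1 => [|i _]; last first.
  by apply: other; rewrite neq_ltn (leq_trans (ltn_ord i) nj).
rewrite subr0 indicE mem_set //; split; first by split => //; exact: WOm.
move=> [i /= ilt ix]; have ij : i != j.
  by apply: contraTneq ilt => ->; rewrite -leqNgt.
by have /eqP := other i ij; rewrite indicE mem_set // oner_eq0.
Qed.

(** Both partial sums stop at [n]. Once the sums over [j] and [k] are exchanged, each [Q] of level
    [k < n] lacks on [W] exactly its pieces of level at least [n], that is, its remainder. *)
Lemma transfer_error (f : T -> R[i]) n x :
  f x * \1_W x - \sum_(j < n) level_sum m p s (restr_grid P W) transfer j x =
  (f x - \sum_(k < n) level_sum m p s P dd k x) * \1_W x +
  (\sum_(k < n) \sum_(Q <- P k) weight k Q * \1_(remainder k Q n) x) * \1_W x.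
Proof.
under eq_bigr do rewrite level_sum_transfer.
rewrite -mulr_suml -mulrBl -mulrDl; have [Wx|Wx] := pselect (W x); last first.
  have -> : \1_W x = 0 :> R[i] by rewrite indicE memNset.
  by rewrite !mulr0.
congr (_ * _); rewrite -addrA; congr (_ + _).
(* The range [k <= j] is enlarged to [k < n], since the covers with [j < k] are empty. *)
rewrite (eq_bigr (fun j : 'I_n =>
    \sum_(k < n) \sum_(Q <- P k) weight k Q * \1_(cover (F k Q j)) x)); last first.
  move=> j _.
  rewrite (big_ord_widen_cond n xpredT
    (fun k => \sum_(Q <- P k) weight k Q * \1_(cover (F k Q j)) x)) //=.
  rewrite big_mkcond /=; apply: eq_bigr => k _; rewrite ltnS; case: ifP => // /negbT.
  rewrite -ltnNge => jk; rewrite big_seq big1 // => Q Qk.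
  by rewrite cover_empty // indicE memNset // mulr0.
rewrite exchange_big /= -sumrN -[X in _ = X + _]sumrN -big_split /=.
apply: eq_bigr => k _; rewrite level_sumE exchange_big /= -!sumrN -big_split /=.
apply: eq_big_seq => Q Qk; rewrite -(indic_remainder n Qk Wx) -mulr_sumr mulrBr.
by rewrite addKr.
Qed.

Lemma level_lp_restr (e : nat -> set T -> R[i]) k :
  level_lp p (restr_grid P W) e k <= level_lp p P e k.
Proof.
apply: le_powR; first by rewrite invr_ge0 ltW.
  by apply: sumr_ge0 => *; apply: powR_ge0.
rewrite /restr_grid big_filter big_mkcond; apply: ler_sum => A _.
by case: ifP => // _; apply: powR_ge0.
Qed.

Lemma coef_norm_restr (q : \bar R) (e : nat -> set T -> R[i]) : (1 <= q)%E ->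
  (coef_norm p q (restr_grid P W) e <= coef_norm p q P e)%E.
Proof.
move=> q1; apply: le_lq_norm => // k; rewrite lee_fin ?powR_ge0 //.
exact: level_lp_restr.
Qed.

(** Both series estimates rest on a uniform bound [D] of the level norms, which a finite norm gives
    for every [q]; geometric factors do the rest. *)
Lemma besov_rep_transfer (q : \bar R) (f : T -> R[i]) : (1 <= q)%E ->
  besov_rep m p q s P f dd ->
  besov_rep m p q s (restr_grid P W) (fun x => f x * \1_W x) transfer.
Proof.
move=> q1 [[mf fp] _ cvf dfin].
have tfin : (coef_norm p q P transfer < +oo)%E.
  apply: le_lt_trans (coef_norm_transfer q1 dfin) _.
  apply: lte_mul_pinfty => //.
  by rewrite lee_fin divr_ge0 ?powR_ge0 // subr_ge0 ltW // powR_lt1 // subr_gt0.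
have L0 (e : nat -> set T -> R[i]) k : 0 <= level_lp p P e k by apply: powR_ge0.
have bounded e : (coef_norm p q P e < +oo)%E ->
    exists2 D, 0 <= D & forall k, level_lp p P e k <= D.
  move=> efin; have e0 : (0 <= coef_norm p q P e)%E.
    by apply: lq_norm_ge0 => k; rewrite lee_fin.
  exists (fine (coef_norm p q P e)) => [|k]; first exact: fine_ge0.
  by rewrite -lee_fin fineK ?ge0_fin_numE //; apply: coord_le_lq_norm.
have cs0 : 0 <= c `^ s by apply: powR_ge0.
have cs1 : c `^ s < 1 by apply: powR_lt1.
split.
- split; first exact: cmeasurable_indicM.
  apply: le_lt_trans fp; apply: le_Lpnorm => //; first exact: cmeasurable_indicM.
  move=> x; rewrite cabsM indicC cabs_real ?indicE //.
  by case: (_ \in _); rewrite ?mulr1 // mulr0 cabs_ge0.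
- have [D D0 LD] := bounded _ tfin.
  apply: (@le_lt_trans _ _ (D / (1 - c `^ s))%:E); last exact: ltry.
  apply: lime_le; first by apply: is_cvg_nneseries => *; apply: Lnorm_ge0.
  apply: nearW => n; apply: (@le_trans _ _ (\sum_(0 <= k < n) ((c `^ s) ^+ k * D)%:E)%E).
    apply: lee_sum => k _; apply: le_trans (Lpnorm_level_sum_le _ _ _) _.
    + by rewrite filter_uniq ?(cell_uniq ctP).
    + by move=> A; rewrite mem_restr_grid => /andP[].
    + by rewrite lee_fin ler_wpM2l ?exprn_ge0 // (le_trans (level_lp_restr _ _)).
  rewrite sumEFin lee_fin big_mkord -mulr_suml mulrC ler_wpM2l //.
  exact: geometric_sum_le.
- have [D D0 LD] := bounded _ dfin.
  set K := (C / (1 - tau)) `^ p^-1; have K0 : 0 <= K by apply: powR_ge0.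
  have rho0 : 0 <= rho by apply: powR_ge0.
  have rho1 : rho < 1 by apply: powR_lt1; rewrite subr_gt0.
  have mlevel k : cmeasurable setT (level_sum m p s P dd k).
    rewrite (_ : level_sum _ _ _ _ _ _ = fun x => \sum_(Q <- P k) weight k Q * \1_(id Q) x).
      by apply: cmeasurable_cells => A /(cell_measurable ctP).
    by apply/funext => x; rewrite level_sumE.
  have mrem n k : cmeasurable setT
      (fun x => \sum_(Q <- P k) weight k Q * \1_(remainder k Q n) x).
    by apply: cmeasurable_cells => Q Qk; apply: remainder_measurable.
  pose err n x := f x - \sum_(k < n) level_sum m p s P dd k x.
  have merr n : cmeasurable setT (err n).
    by apply: cmeasurableB => //; apply: cmeasurable_sum.
  have indic_le (u : T -> R[i]) x : cabs (u x * \1_W x) <= cabs (u x).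
    rewrite cabsM indicC cabs_real ?indicE //.
    by case: (_ \in _); rewrite ?mulr1 // mulr0 cabs_ge0.
  apply: (@squeeze_cvge _ _ _ _ (fun=> 0%E) _
    (fun n => Lpnorm m p (err n) + (K * D / (1 - rho) * (c `^ s) ^+ n)%:E)%E).
  + apply: nearW => n; rewrite Lnorm_ge0 /=.
    under [X in (Lpnorm _ _ X <= _)%E]eq_fun do rewrite transfer_error.
    pose rem x := \sum_(k < n) \sum_(Q <- P k) weight k Q * \1_(remainder k Q n) x.
    have mremn : cmeasurable setT rem by apply: cmeasurable_sum.
    have mD : cmeasurable setT (fun x => err n x * \1_W x + rem x * \1_W x).
      rewrite (_ : (fun x => _) =
        (fun x => (f x - (\sum_(k < n) level_sum m p s P dd k x - rem x)) * \1_W x)).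
        apply: cmeasurable_indicM => //; apply: cmeasurableB => //.
        by apply: cmeasurableB => //; apply: cmeasurable_sum.
      by apply/funext => x; rewrite -mulrDl /err opprB addrA addrAC.
    apply: le_trans (@LpnormD _ _ _ m p (fun x => err n x * \1_W x)
      (fun x => rem x * \1_W x) p1 _ _ mD) _; try exact: cmeasurable_indicM.
    apply: leeD; first by apply: le_Lpnorm => //; exact: cmeasurable_indicM.
    apply: (@le_trans _ _ (Lpnorm m p rem)).
      by apply: le_Lpnorm => //; exact: cmeasurable_indicM.
    apply: le_trans (Lpnorm_sum m n p1 (mrem n)) _.
    apply: (@le_trans _ _ (\sum_(k < n) (K * D * (c `^ s) ^+ n * rho ^+ (n - k))%:E)%E).
      apply: lee_sum => k _; apply: le_trans (Lpnorm_remainder (ltnW (ltn_ord k))) _.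
      by rewrite lee_fin -/K !ler_wpM2r ?exprn_ge0 ?ler_wpM2l.
    rewrite sumEFin lee_fin -mulr_sumr.
    rewrite (_ : K * D / (1 - rho) * _ = K * D * (c `^ s) ^+ n * (1 - rho)^-1); last by ring.
    rewrite ler_wpM2l ?mulr_ge0 ?exprn_ge0 //.
    (* The exponents [n - k] run over [1..n]: this is the geometric sum with [n.+1] terms without
       its term of index 0. *)
    apply: le_trans (geometric_sum_le n.+1 rho0 rho1).
    rewrite big_ord_recl [X in _ <= X + _]expr0 (reindex_inj (@rev_ord_inj n)).
    apply: ler_wpDl => //; apply: ler_sum => i _ /=.
    by rewrite subKn.
  + exact: cvg_cst.
  + rewrite -[X in _ --> X](adde0 0%E); apply: cvgeD => //.
    apply: cvg_EFin; first exact: nearW.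
    rewrite -[X in _ --> X](mulr0 (K * D / (1 - rho))).
    by apply: cvgMr; apply: cvg_expr; rewrite ger0_norm.
- exact: le_lt_trans (coef_norm_restr _ q1) tfin.
Qed.
End Restriction.
End Transfer.

(** * Regular slicing *)

Lemma sum_at_most_one (R : realType) (l : seq nat) (B : pred nat) (x : R) :
  0 <= x -> uniq l ->
  (forall r r', r \in l -> r' \in l -> B r -> B r' -> r = r') ->
  \sum_(r <- l) (if B r then x else 0) <= x.
Proof.
move=> x0 ul one; have [/hasP[r rl Br]|/hasPn nB] := boolP (has B l).
  rewrite (bigD1_seq r) //= Br big_seq_cond big1 ?addr0 // => r' /andP[r'l r'r].
  by case: ifP => // Br'; rewrite (one _ _ r'l rl Br' Br) eqxx in r'r.
by rewrite big_seq big1 // => r /nB /negbTE ->.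
Qed.

(** With the sums exchanged, each cell is counted for at most one [r], so that summing over [r]
    costs only the bound [b] on the weights. *)
Lemma esum_disjoint_le (R : realType) (T : Type) (s : seq (set T)) (Lam : set nat)
    (W : nat -> set T) (x : set T -> R) (a : nat -> R) (b : R) :
  0 <= b -> (forall A, 0 <= x A) -> (forall r, Lam r -> a r <= b) ->
  (forall A r r', A \in s -> Lam r -> Lam r' -> A `<=` W r -> A `<=` W r' -> r = r') ->
  (\esum_(r in Lam) (a r * \sum_(A <- s | `[< A `<=` W r >]) x A)%:E <=
   (b * \sum_(A <- s) x A)%:E)%E.
Proof.
move=> b0 x0 ab one; apply: ge_ereal_sup => _ [X [finX XLam] <-].
rewrite fsbig_finite //= sumEFin lee_fin; set l := finmap.enum_fset _.
have Xin r : r \in l -> Lam r.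
  by rewrite /l [_ \in _]in_fset_set // inE => /XLam.
apply: (@le_trans _ _ (\sum_(r <- l)
    b * \sum_(A <- s | `[< A `<=` W r >]) x A)).
  rewrite big_seq [leRHS]big_seq; apply: ler_sum => r /Xin Lr.
  by rewrite ler_wpM2r ?sumr_ge0 ?ab.
rewrite -mulr_sumr ler_wpM2l //.
rewrite (eq_bigr (fun r => \sum_(A <- s) if `[< A `<=` W r >] then x A else 0));
  last by move=> r _; rewrite big_mkcond.
rewrite exchange_big /= big_seq [leRHS]big_seq; apply: ler_sum => A As.
apply: sum_at_most_one => // [|r r']; first exact: finmap.fset_uniq.
move=> /Xin Lr /Xin Lr' /asboolP AW /asboolP AW'.
exact: one AW AW'.
Qed.

Section Transport.
Context {R : realType} d {T : measurableType d} (m : probability T R).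

(** Assumption PLAIN identifies two grids by their members; their lists may still be ordered
    differently. *)
Lemma besov_rep_perm (p : R) (q : \bar R) (s : R) (G1 G2 : nat -> seq (set T))
    (f : T -> R[i]) (e : nat -> set T -> R[i]) :
  (forall k, perm_eq (G1 k) (G2 k)) ->
  besov_rep m p q s G1 f e -> besov_rep m p q s G2 f e.
Proof.
move=> G12.
have Es : level_sum m p s G2 e = level_sum m p s G1 e.
  by apply/funext => k; apply/funext => x; apply/esym/perm_big.
have El : level_lp p G2 e = level_lp p G1 e.
  by apply/funext => k; congr (_ `^ _); apply/esym/perm_big.
by rewrite /besov_rep /coef_norm El Es.
Qed.

Lemma besov_loc_ge0 (p : R) (q : \bar R) (s : R) (G : nat -> seq (set T))
    (W : set T) (g : T -> R[i]) : (0 <= besov_loc m p q s G W g)%E.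
Proof.
apply: le_ereal_inf_tmp => _ [e _ <-]; apply: lq_norm_ge0 => k.
by rewrite lee_fin powR_ge0.
Qed.

End Transport.

Section PotentialConstant.
Context {R : realType} {dI dJ : measure_display} {I : measurableType dI}
  {J : measurableType dJ} (m : probability I R) (mu : probability J R).

(* A branch maps some cell [W] of [H] into a cell of [G], where the bound on the
   (nonnegative) local Besov norm of the potential forces its constant to be nonnegative. *)
Lemma regular_potential_cst_ge0 (P : nat -> seq (set I)) (H : nat -> seq (set J))
    (s p : R) (q : \bar R) (beta : R) a eps CDGD1 CDGD2 CDC1 CDC2 CDRP G Jh Ih h g :
  good_grid mu H ->
  branch m mu P H s p a eps CDGD1 CDGD2 CDC1 CDC2 G Jh Ih h ->
  regular_potential m mu H p q s beta eps CDRP G Jh Ih h g ->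
  0 <= CDRP.
Proof.
move=> [[_ mH _ _] _] [_ [[_ mG [k Gk] _] _] nullQ regQ _] pot.
case E : (G k) Gk => [//|Q l] _.
have Qk : Q \in G k by rewrite E mem_head.
have [mQ QI Q0] := mG _ _ Qk.
have GQ : in_grid G Q by exists k.
have [F [[_ FH _ _ UF] _]] := regQ _ GQ.
have mh : measurable (hpre Jh h Q).
  rewrite -UF; apply: bigcup_measurable => j _.
  apply: fin_bigcup_measurable; first exact: finite_seq.
  by move=> A AF; have [] := mH j A (FH _ _ AF).
(* By condition (I) of a branch the preimage of [Q] is not null; it is then nonempty, and its
   decomposition contains a cell [W]. *)
have h0 : (0 < mu (hpre Jh h Q))%E.
  rewrite lt0e measure_ge0 andbT; apply/eqP => /(nullQ _ mQ QI) mQ0.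
  by rewrite mQ0 ltxx in Q0.
have [x hx] : exists x, hpre Jh h Q x.
  by apply/set0P/negP => /eqP h00; rewrite h00 measure0 ltxx in h0.
move: hx; rewrite -UF => -[j _ [W WF Wx]].
have Wsub : W `<=` hpre Jh h Q by rewrite -UF => y Wy; exists j => //; exists W.
have Wj : W \in H j := FH _ _ WF.
have [mW _ W0] := mH _ _ Wj.
have := pot W Q (ex_intro _ j Wj) GQ (fun y Wy => (Wsub y Wy).1) QI.
have hW : h @` W `<=` Q by move=> _ [y Wy <-]; exact: (Wsub y Wy).2.
move=> /(_ hW)/(le_trans (besov_loc_ge0 _ _ _ _ _ _ _)); rewrite lee_fin.
rewrite pmulr_lge0 ?powR_gt0 ?msr_gt0 // pmulr_lge0 // powR_gt0 //.
by rewrite divr_gt0 // msr_gt0.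
Qed.

End PotentialConstant.

Unset Implicit Arguments.

Theorem mainTheorem6 (R : realType) (dI : measure_display) (I : measurableType dI)
  (m : probability I R) (P : nat -> seq (set I))
  (p : R) (q : \bar R) (s beta : R) :
  good_grid m P ->
  1 <= p -> (1 <= q)%E ->
  0 < s -> s < beta -> beta < p^-1 ->
  exists CGSR : R,
  forall (dJ : measure_display) (J : measurableType dJ) (mu : probability J R)
    (H : nat -> seq (set J)) (eps gam del : R)
    (Lam : set nat) (Ir : nat -> set I) (Jr : nat -> set J)
    (h : nat -> J -> I) (a : nat -> nat)
    (epsr CDGD1 CDGD2 CDC1 CDC2 CDRP : nat -> R)
    (G : nat -> nat -> seq (set I)) (g : nat -> J -> R[i]) (Crp : R),
  (* standing assumptions *)
  good_grid mu H ->
  0 < eps -> 0 <= gam <= 1 -> 0 < del ->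
  s + eps <= p^-1 -> del < Num.max s eps ->
  (forall r, Lam r -> measurable (Ir r) /\ measurable (Jr r)) ->
  (forall r, Lam r -> `|epsr r| = eps) ->
  (forall r, Lam r ->
     branch m mu P H s p (a r) (epsr r) (CDGD1 r) (CDGD2 r) (CDC1 r) (CDC2 r)
       (G r) (Jr r) (Ir r) (h r)) ->
  (forall r, Lam r ->
     regular_potential m mu H p q s beta (epsr r) (CDRP r) (G r) (Jr r) (Ir r)
       (h r) (g r)) ->
  <<s [set Q | exists r k, [/\ Lam r, Q \in G r k & Q `<=` Ir r]] `|`
      [set Q | exists k, Q \in P k /\ forall r, Lam r -> Q `&` Ir r = set0] >>
    = measurable ->
  (exists theta : R, theta < 1 /\
     forall r, Lam r -> CDRS2 p eps (CDC2 r) (CDGD2 r) <= theta) ->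
  (exists C : R, 0 <= C /\
     forall f : I -> R[i], inLp m (p / (1 - s * p + del * p)) f ->
       (\esum_(r in Lam) Lpnorm mu 1 (Phi_comp (Jr r) (h r) (g r) f)
          <= C%:E * Lpnorm m (p / (1 - s * p + del * p)) f)%E) ->
  (* Assumption PLAIN *)
  (forall r k, Lam r -> G r k =i [seq Q <- P k | `[< Q `<=` Ir r >]]) ->
  (* hypotheses of the claim *)
  (forall r r', Lam r -> Lam r' -> r <> r' -> Ir r `&` Ir r' = set0) ->
  0 < Crp ->
  strongly_regular m P (1 - beta * p) Crp 0
    (\bigcup_(r in Lam) Ir r) ->
  (forall k Q, Q \in P k -> Q `<=` \bigcup_(r in Lam) Ir r ->
     exists2 r, Lam r & Q `<=` Ir r) ->
  let Th := fun r => Theta p eps gam (a r) (CDGD1 r) (CDGD2 r) (CDC1 r) (CDC2 r) (CDRP r) in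
  let Np := Npow p (Ncount H Lam Jr) in
  let Cf := (Np * (Crp `^ p^-1)%:E * ereal_sup [set (Th r)%:E | r in Lam])%E in
  (Cf < +oo)%E ->
  forall (f : I -> R[i]) (dd : nat -> set I -> R[i]),
    besov_rep m p q s P f dd ->
    regular_slicing m P G Lam Ir Th Np p q s (CGSR * fine Cf) f dd.
Proof.
move=> gP p1 q1 s0 sbeta betap.
have [c [c0 c1 ctP]] := good_grid_cell_tree gP.
have p0 : 0 < p by apply: lt_le_trans p1.
(* The constant is fixed before [J], the branches and [Crp] are introduced. *)
set rho := c `^ (beta - s); exists (1 - rho)^-1.
move=> dJ J mu H eps gam del Lam Ir Jr h a epsr CDGD1 CDGD2 CDC1 CDC2 CDRP G g Crp.
move=> gH _ _ _ _ _ mIJ _ br pot _ _ _ plain disj Crp0 sreg catch Th Np Cf Cfin f dd rep.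
set Om := \bigcup_(r in Lam) Ir r in sreg catch.
have Th0 r : Lam r -> 0 <= Th r.
  move=> Lr; rewrite /Th /Theta !mulr_ge0 ?powR_ge0 //.
  exact: regular_potential_cst_ge0 gH (br r Lr) (pot r Lr).
have /choice[F0 HF0] : forall kQ : nat * set I, exists D : nat -> seq (set I),
    kQ.2 \in P kQ.1 -> decomposition P (kQ.2 `&` Om) D /\
    forall j, \sum_(A <- D j) msr m A `^ (1 - beta * p) <=
      Crp * msr m kQ.2 `^ (1 - beta * p).
  move=> [k Q] /=.
  have [Qk|Qk] := boolP (Q \in P k); last by exists (fun=> [::]).
  by have [F HF] := sreg k Q isT Qk; exists F.
pose F k Q := F0 (k, Q).
have decF k Q : Q \in P k -> decomposition P (Q `&` Om) (F k Q).
  by move=> Qk; have [] := HF0 (k, Q) Qk.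
have sumF k Q j : Q \in P k -> \sum_(A <- F k Q j) msr m A `^ (1 - beta * p) <=
    Crp * msr m Q `^ (1 - beta * p).
  by move=> Qk; have [_] := HF0 (k, Q) Qk; apply.
have rho1 : rho < 1 by apply: powR_lt1; rewrite ?subr_gt0.
have d0 : (0 <= coef_norm p q P dd)%E.
  by apply: lq_norm_ge0 => k; rewrite lee_fin powR_ge0.
have restrE r k : Lam r -> perm_eq (restr_grid P (Ir r) k) (restr_grid (G r) (Ir r) k).
  move=> Lr; have [_ [[uG _ _ _] _] _ _ _] := br r Lr.
  apply: uniq_perm; rewrite ?filter_uniq ?(cell_uniq ctP) // => A.
  by rewrite !mem_filter plain // mem_filter; case: `[< _ >].
have one k A r r' : A \in P k -> Lam r -> Lam r' -> A `<=` Ir r -> A `<=` Ir r' -> r = r'.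
  move=> Ak Lr Lr' Ar Ar'; have [x Ax] := cell_nonempty ctP Ak.
  apply: contrapT => rr'; have : (Ir r `&` Ir r') x by split; [exact: Ar|exact: Ar'].
  by rewrite disj.
pose t := transfer m P p s F dd.
exists (fun=> t); split; last first.
- move=> dd0 r j A Lr _; exact: transfer_ge0.
- right.
  set E := fun j => _.
  have E0 j : (0 <= E j)%E by apply: poweR_ge0.
  have Np0 : (0 <= Np)%E by rewrite /Np /Npow; case: ifP => // _; apply: poweR_ge0.
  have Cp0 : (0 < (Crp `^ p^-1)%:E)%E by rewrite lte_fin powR_gt0.
  set S := ereal_sup [set (Th r)%:E | r in Lam] in Cf Cfin *.
  have ThS r : Lam r -> ((Th r)%:E <= S)%E.
    by move=> Lr; apply: ereal_sup_ubound; exists r.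
  (* For empty [Lam] the supremum [S] is [-oo] and [fine Cf] is the junk value [0]. *)
  have Cf0 : 0 <= fine Cf.
    have [L0|/set0P[r Lr]] := eqVneq Lam set0.
      rewrite /Cf /S L0 image_set0 ereal_sup0.
      have [->|NC] := eqVneq (Np * (Crp `^ p^-1)%:E)%E 0%E; first by rewrite mul0e.
      by rewrite gt0_muleNy // lt0e NC mule_ge0 // ltW.
    apply: fine_ge0; rewrite !mule_ge0 ?(ltW Cp0) //.
    by apply: le_trans (ThS r Lr); rewrite lee_fin Th0.
  have rhs0 : (0 <= ((1 - rho)^-1 * fine Cf)%:E * coef_norm p q P dd)%E.
    by rewrite mule_ge0 // lee_fin mulr_ge0 // invr_ge0 subr_ge0 ltW.
  have [->|NpN0] := eqVneq Np 0%E; first by rewrite mul0e.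
  (* This covers [Np = +oo], where [Cf < +oo] forces all [Th r] to vanish. *)
  have [Tz|nTz] := pselect (forall r, Lam r -> Th r = 0).
    suff -> : lq_norm q E = 0%E by rewrite mule0.
    apply/eqP; rewrite eq_le lq_norm_ge0 // andbT.
    apply: le_trans (le_lq_norm q1 E0 (v := fun=> 0%E) _) _.
      move=> j; rewrite /E esum1 ?poweR0r // ?invr_neq0 ?gt_eqF // => r Lr.
      by rewrite Tz // powR0 ?gt_eqF // mul0r.
    case: q q1 {rep rhs0 d0 pot} => [q'||] //= q1'.
      have q0 : 0 < q' by rewrite -lte_fin (lt_le_trans _ q1').
      rewrite eseries0 => [|k _ _]; last by rewrite powR0 // gt_eqF.
      by rewrite poweR0r // invr_neq0 // gt_eqF.
    by apply: ge_ereal_sup => _ [k _ <-].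
  (* One positive [Th r0] makes all three factors of [Cf] positive, and then [Cf < +oo] forces [Np]
     and [S] to be finite. *)
  have [r0 [Lr0 Thr0]] : exists r, Lam r /\ Th r != 0.
    apply: contrapT => nex; apply: nTz => r Lr; apply/eqP/negPn/negP => Tr.
    by apply: nex; exists r.
  have Np1 : (0 < Np)%E by rewrite lt0e NpN0.
  have S0 : (0 < S)%E.
    by apply: lt_le_trans (ThS r0 Lr0); rewrite lte_fin lt_neqAle eq_sym Thr0 Th0.
  have [n [n0 NpE]] : exists n, 0 < n /\ Np = n%:E.
    case: Np Np1 @Cf Cfin {Np0 NpN0 Cf0 rhs0} => [n||] // n0; first by exists n.
    by rewrite gt0_mulye // gt0_mulye.
  have [sg [sg0 SE]] : exists sg, 0 < sg /\ S = sg%:E.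
    case: S S0 @Cf Cfin {ThS Cf0 rhs0} => [sg||] // sg0; first by exists sg.
    by rewrite NpE gt0_muley // mule_gt0.
  have -> : fine Cf = n * Crp `^ p^-1 * sg by rewrite /Cf NpE SE.
  have Th_le r : Lam r -> Th r <= sg by move=> /ThS; rewrite SE lee_fin.
  have tfin := rep; case: tfin => _ _ _ dfin.
  have sgC0 : 0 <= sg * Crp `^ p^-1 by rewrite mulr_ge0 ?powR_ge0 // ltW.
  have u0 j : 0 <= sg * level_lp p P t j by rewrite mulr_ge0 ?powR_ge0 // ltW.
  have L0 k : 0 <= level_lp p P dd k by apply: powR_ge0.
  have key : (lq_norm q E <= (sg * Crp `^ p^-1 / (1 - rho))%:E * coef_norm p q P dd)%E.
    (* As [sg] dominates every [Th r], [E j] is at most [sg] times the full level norm of [t]; the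
       convolution bound applies with [K = sg * Crp ^ (1/p)]. *)
    apply: (@le_trans _ _ (lq_norm q (fun j => (sg * level_lp p P t j)%:E))); last first.
      apply: lq_norm_geometric_convolution => //; first exact: powR_ge0.
      move=> j; rewrite -mulrA ler_wpM2l ?(ltW sg0) //.
      exact: (level_lp_transfer c0 c1 ctP p1 sbeta (ltW Crp0) decF sumF).
    apply: le_lq_norm => // j; rewrite /E.
    have -> : (sg * level_lp p P t j)%:E =
        ((sg `^ p * \sum_(A <- P j) cabs (t j A) `^ p)%:E `^ p^-1)%E.
      rewrite poweR_EFin powRM ?powR_ge0 ?sumr_ge0 //; last by move=> *; apply: powR_ge0.
      by rewrite powR_invK ?(ltW sg0).
    apply: le_poweR; first by rewrite invr_ge0 ltW.
      apply: esum_ge0 => r _; rewrite lee_fin mulr_ge0 ?powR_ge0 ?sumr_ge0 //.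
      by move=> *; apply: powR_ge0.
    (* By PLAIN the cells of [G r] are the cells of [P] inside [I_r], so all [r] share the list
       [P j]. *)
    rewrite (eq_esum (b := fun r => (Th r `^ p *
        \sum_(A <- P j | `[< A `<=` Ir r >]) cabs (t j A) `^ p)%:E)); last first.
      by move=> r Lr; rewrite -(perm_big _ (restrE r j Lr)) big_filter.
    apply: esum_disjoint_le; rewrite ?powR_ge0 //.
    + by move=> A; apply: powR_ge0.
    + by move=> r Lr; apply: le_powR; rewrite ?(ltW p0) ?Th0 ?Th_le.
    + by move=> A r r'; apply: one.
  rewrite NpE; apply: le_trans (lee_wpmul2l _ key) _; first by rewrite lee_fin ltW.
  rewrite muleA -EFinM lee_wpmul2r // lee_fin.
  by rewrite le_eqVlt; apply/orP; left; apply/eqP; field; rewrite gt_eqF // subr_gt0.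
- move=> r Lr; apply: besov_rep_perm (fun k => restrE r k Lr) _.
  apply: (besov_rep_transfer c0 c1 ctP p1 s0 sbeta (ltW Crp0) decF sumF) => //.
  + by have [] := mIJ r Lr.
  + by move=> x Ix; exists r.
  + move=> j A x Aj AOm Ax Ix; have [r' Lr' Ar'] := catch j A Aj AOm.
    suff -> : r = r' by [].
    apply: contrapT => rr'; have : (Ir r `&` Ir r') x by split => //; exact: Ar'.
    by rewrite disj.
Qed.
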